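(* Let $K>0$, $N\in(0,\infty)$ and let $(X,d,m)$ be a metric measure space satisfying $\mathrm{CD}^e(K,N)$ with $m\in\mathcal P_2(X,d)$. Then for all $\mu\in\mathcal P_2(X,d,m)$: $$KN\left[\exp\Big(\frac2N\mathrm{Ent}(\mu)\Big)-1\right]\le I(\mu).$$
   Context: A metric measure space $(X,d,m)$ consists of a complete separable metric space $(X,d)$ and a locally finite, $\sigma$-finite Borel measure $m$ on $X$. $\mathcal P_2(X,d)$ is the set of Borel probability measures on $X$ with finite second moment; $\mathcal P_2(X,d,m)$ is its subset of measures absolutely continuous with respect to $m$; $W_2$ is the $L^2$-Wasserstein distance. $\mathrm{Ent}(\mu)=\int\rho\log\rho\,dm$ if $\mu=\rho m$ and $(\rho\log\rho)_+$ is $m$-integrable, and $\mathrm{Ent}(\mu)=+\infty$ otherwise; $\mathcal P_2^*(X,d,m)$ is the set of $\mu\in\mathcal P_2(X,d)$ with finite entropy; $U_N(\mu)=\exp(-\frac1N\mathrm{Ent}(\mu))$. For $\kappa>0$, $\theta\ge0$, $t\in[0,1]$: $\sigma_\kappa^{(t)}(\theta)=\sin(\sqrt\kappa t\theta)/\sin(\sqrt\kappa\theta)$ if $0<\kappa\theta^2<\pi^2$; $=t$ if $\theta=0$; $=+\infty$ if $\kappa\theta^2\ge\pi^2$. $\mathrm{CD}^e(K,N)$: for each pair $\mu_0,\mu_1\in\mathcal P_2^*(X,d,m)$ there is a constant speed $W_2$-geodesic $(\mu_t)_{t\in[0,1]}$ in $\mathcal P_2^*(X,d,m)$ from $\mu_0$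 to $\mu_1$ such that for all $t\in[0,1]$: $U_N(\mu_t)\ge\sigma_{K/N}^{(1-t)}(W_2(\mu_0,\mu_1))\,U_N(\mu_0)+\sigma_{K/N}^{(t)}(W_2(\mu_0,\mu_1))\,U_N(\mu_1)$. Cheeger energy: for Lipschitz $f$ let $|\nabla f|(x)=\limsup_{y\to x}|f(y)-f(x)|/d(x,y)$. For $f\in L^2(X,m)$, $\mathrm{Ch}(f)=\inf\{\liminf_n\frac12\int|\nabla f_n|^2dm\}$, the infimum over all sequences of Lipschitz functions $f_n\to f$ in $L^2(X,m)$; $D(\mathrm{Ch})=\{\mathrm{Ch}<\infty\}$ and $\mathrm{Ch}(f)=\frac12\int|\nabla f|_w^2dm$ with $|\nabla f|_w$ the minimal weak upper gradient (Ambrosio–Gigli–Savaré). Fisher information: $I(\mu)=4\int|\nabla\sqrt f|_w^2\,dm$ (so $I(\mu)=8\,\mathrm{Ch}(\sqrt f)$) if $\mu=fm$ with $\sqrt f\in D(\mathrm{Ch})$, and $I(\mu)=+\infty$ otherwise. *)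

(* Defs.v *)
From HB Require Import structures.
From mathcomp Require Import all_boot all_order all_algebra.
From mathcomp Require Import all_classical all_reals all_analysis.

Set Implicit Arguments.
Unset Strict Implicit.
Unset Printing Implicit Defensive.

Import Order.TTheory GRing.Theory Num.Theory.
Import numFieldNormedType.Exports.

Local Open Scope classical_set_scope.
Local Open Scope ring_scope.

#[short(type="completeMetricType")]
HB.structure Definition CompleteMetric (K : numDomainType) :=
  {M of Metric K M & CompletePseudoMetric K M}.

Definition separable (T : topologicalType) : Prop :=
  exists2 D : set T, countable D & dense D.

(* X with its Borel sigma-algebra. On borel X * borel X the library puts the
   product sigma-algebra, which is the Borel one because X is separable. *)
Notation borel X := (g_sigma_algebraType (@open X)).

Section metric_measure_space.
Context (R : realType) (X : completeMetricType R).

Local Open Scope ereal_scope.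

Definition locally_finite (m : {measure set (borel X) -> \bar R}) : Prop :=
  forall x : X, exists2 U : set X, nbhs x U & open U /\ m U < +oo.

Definition P2 : set {measure set (borel X) -> \bar R} :=
  [set mu : {measure set (borel X) -> \bar R} | mu [set: borel X] = 1 /\
    exists x0 : X, \int[mu]_x ((mdist x0 (x : X)) ^+ 2)%:E < +oo].

Definition coupling (mu nu : probability (borel X) R) :
    set (probability (borel X * borel X)%type R) :=
  [set g | forall A : set (borel X), measurable A ->
    g (A `*` setT) = mu A /\ g (setT `*` A) = nu A].

Definition W2 (mu nu : probability (borel X) R) : \bar R :=
  sqrte (ereal_inf
    [set \int[g]_z ((mdist (z.1 : X) (z.2 : X)) ^+ 2)%:E | g in coupling mu nu]).

Definition W2_geodesic (mu_ : R -> probability (borel X) R) : Prop :=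
  forall s t : R, (0 <= s <= 1)%R -> (0 <= t <= 1)%R ->
    W2 (mu_ s) (mu_ t) = `|t - s|%:E * W2 (mu_ 0%R) (mu_ 1%R).

(* Limit superior of |f y - f x| / d(x, y) as y tends to x. The point y = x is
   left in the neighbourhoods: it contributes the quotient 0 / 0 = 0, which
   changes nothing at accumulation points and makes the slope 0 at isolated
   points. *)
Definition slope (f : X -> R) (x : X) : \bar R :=
  limf_esup (fun y : X => (`|f y - f x| / mdist x y)%:E) (nbhs x).

Definition is_lipschitz (f : X -> R) : Prop :=
  exists L : R, forall x y : X, (`|f x - f y| <= L * mdist x y)%R.

Section reference_measure.
Variable m : {sigma_finite_measure set (borel X) -> \bar R}.

Definition P2ac : set (probability (borel X) R) :=
  [set mu : probability (borel X) R | P2 mu /\ mu `<< m].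

(* Meaningful only when mu `<< m. *)
Definition density (mu : probability (borel X) R) (x : borel X) : R :=
  fine (Radon_Nikodym_SigmaFinite.f mu m x).

(* ln 0 = 0, so the integrands vanish where the density does. *)
Definition Ent (mu : probability (borel X) R) : \bar R :=
  let rho := density mu in
  if `[< mu `<< m /\
         m.-integrable setT (fun x => (Num.max (rho x * ln (rho x)) 0)%:E) >]
  then \int[m]_x (rho x * ln (rho x))%:E
  else +oo.

Definition P2star : set (probability (borel X) R) :=
  [set mu : probability (borel X) R | P2 mu /\ Ent mu \is a fin_num].

Definition U (N : R) (mu : probability (borel X) R) : \bar R :=
  expeR (- (N^-1%:E * Ent mu)).

(* Defined for kappa > 0 and 0 <= theta. *)
Definition sigma (kappa t : R) (theta : \bar R) : \bar R :=
  match theta with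
  | r%:E =>
      if (r == 0)%R then t%:E
      else if (kappa * r ^+ 2 < pi ^+ 2)%R then
        (sin (Num.sqrt kappa * t * r) / sin (Num.sqrt kappa * r))%:E
      else +oo
  | _ => +oo
  end.

(* Entropic curvature-dimension condition, for K > 0 and N > 0. *)
Definition CDe (K N : R) : Prop :=
  forall mu0 mu1 : probability (borel X) R, P2star mu0 -> P2star mu1 ->
  exists mu_ : R -> probability (borel X) R,
    [/\ mu_ 0%R = mu0, mu_ 1%R = mu1, W2_geodesic mu_ &
      forall t : R, (0 <= t <= 1)%R ->
        P2star (mu_ t) /\
        sigma (K / N) (1 - t) (W2 mu0 mu1) * U N mu0
          + sigma (K / N) t (W2 mu0 mu1) * U N mu1 <= U N (mu_ t)].

Definition lipschitz_approx (f : X -> R) : set (nat -> X -> R) :=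
  [set f_ | (forall n, is_lipschitz (f_ n)) /\
    'N[m]_2%:E[(fun x : borel X => (f_ n x - f x)%:E)] @[n --> \oo] --> 0].

(* For f in L^2(m); the infimum of the empty set is +oo. *)
Definition Ch (f : X -> R) : \bar R :=
  ereal_inf
    [set limn_einf (fun n =>
           2^-1%:E * \int[m]_(x in [set: borel X]) (slope (f_ n) x) ^+ 2)
    | f_ in lipschitz_approx f].

(* The integral of the squared minimal weak upper gradient of f is 2 * Ch f on
   the domain {Ch < +oo}, so 4 times that integral is 8 * Ch f; off the domain
   8 * Ch f is +oo. The square root of a probability density is in L^2(m). *)
Definition Fisher (mu : probability (borel X) R) : \bar R :=
  if `[< mu `<< m >] then 8%:E * Ch (fun x => Num.sqrt (density mu x))
  else +oo.

End reference_measure.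
End metric_measure_space.

(* Main.v *)
(* Apply CD^e(K, N) along a W_2-geodesic mu_t from mu to m itself, whose entropy
   is 0. With theta = sqrt (K / N) W_2(mu, m) and u = U_N(mu), differentiating the
   concavity inequality at t = 0 gives
     1 / u <= cos theta + (sin theta / theta) (- d/dt Ent(mu_t)) / N,
   so if - d/dt Ent(mu_t) <= sqrt(I(mu)) W_2(mu, m) the Cauchy-Schwarz inequality
   for (cos theta, sin theta) yields 1 / u^2 <= 1 + I(mu) / (K N), which is the claim.

   The bound on the derivative is proved only for mu = h^2 m with h Lipschitz and
   bounded away from 0 and infinity, where Gibbs' inequality reduces
   Ent(mu) - Ent(mu_t) to the integral of ln h(x)^2 - ln h(y)^2 against a nearly
   optimal coupling of mu and mu_t, and difference quotients of h at scale r
   decrease to the slope of h as r tends to 0.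

   For general mu, truncate the Lipschitz functions approximating the square root of
   the density to [1/k, k]: truncation does not increase slopes, for fixed k all
   integrals pass to the limit, and k is sent to infinity with Fatou's lemma. *)

From HB Require Import structures.
Require Import Defs.
From mathcomp Require Import all_boot all_order all_algebra.
From mathcomp Require Import all_classical all_reals all_analysis.
From mathcomp Require Import measurable_realfun ring lra.

Import Order.TTheory GRing.Theory Num.Theory.
Import numFieldNormedType.Exports.

Local Open Scope classical_set_scope.
Local Open Scope ring_scope.

Set Implicit Arguments.
Unset Strict Implicit.
Unset Printing Implicit Defensive.

(** * Borel functions and difference quotients on a metric space *)

Section borel_metric.
Context (R : realType) (X : completeMetricType R).

Lemma open_mdist (A : set X) :
  (forall x, A x -> exists2 e : R, 0 < e & forall y, mdist x y < e -> A y) ->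
  open A.
Proof.
move=> h; rewrite openE => x /h[e e0 xA].
by apply/nbhs_ballP; exists e => //= y; rewrite ballEmdist; exact: xA.
Qed.

(** Lower semicontinuous functions are Borel. In this form the criterion also covers [dquot], a
    supremum over open balls that need not be continuous. *)
Lemma measurable_open_gt (f : X -> R) :
  (forall a, open [set x | a < f x]) -> measurable_fun setT (f : borel X -> R).
Proof.
move=> fo; apply: (measurability _ (RGenOInfty.measurableE R)).
move=> /= _ [_ [a ->]] <-; apply: measurableI => //.
apply: sub_sigma_algebra.
rewrite (_ : _ @^-1` _ = [set x | a < f x]); first exact: fo.
by apply/seteqP; split => x /=; rewrite in_itv/= andbT.
Qed.

Definition lipschitz_bound (L : R) (f : X -> R) :=
  forall x y, `|f x - f y| <= L * mdist x y.

Lemma is_lipschitzP (f : X -> R) :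
  is_lipschitz f -> exists2 L, 0 <= L & lipschitz_bound L f.
Proof.
move=> [L fL]; exists `|L| => // x y; apply: le_trans (fL x y) _.
by rewrite ler_wpM2r ?mdist_ge0// ler_norm.
Qed.

Lemma lipschitz_measurable (f : X -> R) :
  is_lipschitz f -> measurable_fun setT (f : borel X -> R).
Proof.
move=> /is_lipschitzP[L L0 fL]; apply: measurable_open_gt => a.
have L1 : 0 < L + 1 by rewrite ltr_wpDl.
apply: open_mdist => x /= afx; exists ((f x - a) / (L + 1)).
  by rewrite divr_gt0 ?subr_gt0.
move=> y; rewrite ltr_pdivlMr// => xy.
have := fL x y; rewrite ler_norml => /andP[_ fxy].
by have := mdist_ge0 x y; nra.
Qed.

Lemma mdist_lipschitz (x0 : X) : lipschitz_bound 1 (mdist x0).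
Proof.
move=> x y; rewrite mul1r ler_norml.
have := metric_triangle x0 x y; have := metric_triangle x0 y x.
by rewrite (metric_sym y x); lra.
Qed.

Lemma mdist_measurable (x0 : X) : measurable_fun setT (mdist x0 : borel X -> R).
Proof. by apply: lipschitz_measurable; exists 1; exact: mdist_lipschitz. Qed.

(** The distance has to be measurable for the product sigma-algebra. By the triangle inequality and
    density, it is below [a] exactly when some [q] in the countable dense set satisfies
    [mdist q z.1 + mdist q z.2 < a]. *)
Lemma prod_mdist_measurable : separable X ->
  measurable_fun setT
    (fun z : (borel X * borel X)%type => mdist (z.1 : X) (z.2 : X)).
Proof.
move=> [D cD dD]; apply: (measurability _ (RGenInftyO.measurableE R)).
move=> /= _ [_ [a ->]] <-; apply: measurableI => //.
pose F (q : X) := [set z : (borel X * borel X)%type |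
  mdist q (z.1 : X) + mdist q (z.2 : X) < a].
rewrite (_ : _ @^-1` _ = \bigcup_(q in D) F q).
  rewrite bigcup_set_type; apply: countable_bigcupT_measurable => [|q].
    by rewrite (eq_countable (card_setT D)).
  move: (val q) => {}q;
    rewrite (_ : F q = setT `&` (fun z : (borel X * borel X)%type =>
      mdist q (z.1 : X) + mdist q (z.2 : X)) @^-1` `]-oo, a[%classic).
    have mF : measurable_fun setT (fun z : (borel X * borel X)%type =>
      mdist q (z.1 : X) + mdist q (z.2 : X)).
      apply: measurable_funD.
        exact: (measurableT_comp (mdist_measurable q) measurable_fst).
      exact: (measurableT_comp (mdist_measurable q) measurable_snd).
    exact: mF.
  by rewrite setTI; apply/seteqP; split => z /=; rewrite in_itv.
apply/seteqP; split => [z/=|z [q Dq]]; rewrite /F/= in_itv/=; last first.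
  rewrite (metric_sym q (z.1 : X)); apply: le_lt_trans.
  exact: metric_triangle.
(* Half of the gap: [q] within [e] of [z.1] gives a sum below [2 * e] plus the distance, which is
   [a]. *)
move=> za; pose e := (a - mdist (z.1 : X) (z.2 : X)) / 2.
have e0 : 0 < e by rewrite divr_gt0// subr_gt0.
have [|q [/= qe Dq]] := dD (interior (ball (z.1 : X) e)) _ (open_interior _).
  by exists (z.1 : X); exact: nbhsx_ballx.
exists q => //=.
have := interior_subset qe; rewrite ballEmdist/= => zq.
have := metric_triangle q (z.1 : X) (z.2 : X); rewrite (metric_sym q (z.1 : X)).
by move: zq; rewrite /e; lra.
Qed.

Section difference_quotient.
Variables (L : R) (h : X -> R).
Hypotheses (L0 : 0 <= L) (hL : lipschitz_bound L h).

(* The point y = x contributes the junk quotient 0 / 0 = 0. *)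
Definition dquot (r : R) (x : X) : R :=
  sup [set `|h y - h x| / mdist x y | y in [set y | mdist x y < r]].

Lemma dquot_le_lip x y : `|h y - h x| / mdist x y <= L.
Proof.
have [->|xy] := eqVneq x y; first by rewrite subrr normr0 mul0r.
by rewrite ler_pdivrMr ?mdist_gt0// distrC; exact: hL.
Qed.

Let has_sup_dquot r x : 0 < r ->
  has_sup [set `|h y - h x| / mdist x y | y in [set y | mdist x y < r]].
Proof.
move=> r0; split; first by eexists; exists x => //=; rewrite mdistxx.
by exists L => _ [y _ <-]; exact: dquot_le_lip.
Qed.

Lemma dquot_ub r x y : mdist x y < r -> `|h y - h x| / mdist x y <= dquot r x.
Proof.
move=> xyr; apply: ub_le_sup; last by exists y.
exact: (has_sup_dquot x (le_lt_trans (mdist_ge0 x y) xyr)).2.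
Qed.

Lemma dquot_ge0 r x : 0 < r -> 0 <= dquot r x.
Proof.
by move=> r0; apply: le_trans (@dquot_ub r x x _); rewrite ?mdistxx// divr_ge0.
Qed.

Lemma dquot_le r x : 0 < r -> dquot r x <= L.
Proof.
move=> r0; apply: ge_sup => [|_ [y _ <-]]; last exact: dquot_le_lip.
by case: (has_sup_dquot x r0).
Qed.

Lemma ler_dist_dquot r x y : mdist x y < r ->
  `|h y - h x| <= dquot r x * mdist x y.
Proof.
move=> xyr; have [->|xy] := eqVneq x y;
  first by rewrite subrr normr0 mdistxx mulr0.
by rewrite -ler_pdivrMr ?mdist_gt0//; exact: dquot_ub.
Qed.

(** [dquot h r] is lower semicontinuous: a point [y] whose quotient at [x] exceeds [a] stays in the
    open ball around every [z] near [x], and its quotient at [z] still exceeds [a]. *)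
Lemma dquot_measurable r :
  0 < r -> measurable_fun setT (dquot r : borel X -> R).
Proof.
move=> r0; apply: measurable_open_gt => a; have [a0|a0] := ltP a 0.
  rewrite (_ : [set x | _] = setT); first exact: openT.
  by apply/seteqP; split => // x _ /=; exact: lt_le_trans (dquot_ge0 x r0).
apply: open_mdist => x /= ax.
have [_ [y /= xyr <-] axy] := sup_gt (has_sup_dquot x r0).1 ax.
(* Since [a] is nonnegative, the junk quotient 0 at [y = x] cannot exceed it. *)
have xy : x != y.
  by apply/eqP => xy; move: axy; rewrite xy subrr normr0 mul0r ltNge a0.
move: axy; rewrite ltr_pdivlMr ?mdist_gt0// => axy.
(* Moving [x] by [d] costs at most [(L + a) * d] of the gap in the numerator; the extra 1 keeps the
   denominator positive. *)
pose e1 := (`|h y - h x| - a * mdist x y) / (L + a + 1).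
have La : 0 < L + a + 1 by rewrite ltr_wpDl ?addr_ge0.
have e10 : 0 < e1 by rewrite divr_gt0// subr_gt0.
exists (Num.min e1 (r - mdist x y)) => [|z];
  first by rewrite lt_min e10 subr_gt0.
rewrite lt_min => /andP[ze1 zr].
have yzr : mdist z y < r.
  by have := metric_triangle z x y; rewrite (metric_sym z x); lra.
apply: lt_le_trans (dquot_ub yzr).
move: ze1; rewrite /e1 ltr_pdivlMr// => ze1.
have d0 := mdist_ge0 x z.
have hyz : a * mdist z y < `|h y - h z|.
  have := metric_triangle z x y; rewrite (metric_sym z x) => t1.
  have : a * mdist z y <= a * mdist x z + a * mdist x y
    by rewrite -mulrDr ler_wpM2l.
  have : `|h y - h x| <= `|h y - h z| + L * mdist x z.
    rewrite (_ : h y - h x = (h y - h z) + (h z - h x)); last by ring.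
    rewrite (le_trans (ler_normD _ _))// lerD2l distrC; exact: hL.
  by move: ze1; nra.
rewrite ltr_pdivlMr// mdist_gt0; apply/eqP => zy.
by move: hyz; rewrite zy subrr normr0 mdistxx mulr0 ltxx.
Qed.

Lemma slope_ge0 x : (0 <= slope h x)%E.
Proof.
apply: limf_esup_ge0 => [|y]; last by rewrite lee_fin divr_ge0// mdist_ge0.
exact: (fun H : nbhs x set0 => nbhs_singleton H).
Qed.

Lemma slope_le_dquot r x : 0 < r -> (slope h x <= (dquot r x)%:E)%E.
Proof.
move=> r0; apply: (@le_trans _ _ (ereal_sup
   [set (`|h y - h x| / mdist x y)%:E | y in ball x r])).
  apply: ereal_inf_lbound; exists (ball x r) => //; exact: nbhsx_ballx.
by apply: ge_ereal_sup => _ [y + <-]; rewrite ballEmdist lee_fin => /dquot_ub.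
Qed.

Lemma slope_fin_num x : slope h x \is a fin_num.
Proof.
rewrite ge0_fin_numE ?slope_ge0//.
exact: le_lt_trans (slope_le_dquot x (@ltr01 R)) (ltry _).
Qed.

Lemma slope_le x : (slope h x <= L%:E)%E.
Proof.
by apply: le_trans (slope_le_dquot x (@ltr01 R)) _; rewrite lee_fin dquot_le.
Qed.

(** The slope is an infimum over neighbourhoods of [x], and the balls of radius [1 / (k + 1)] are
    cofinal among these. This yields measurability of the slope and its integrals as limits. *)
Lemma dquot_cvg_slope x :
  dquot k.+1%:R^-1 x @[k --> \oo] --> fine (slope h x).
Proof.
apply/cvgrPdist_le => e e0.
have : (slope h x < (fine (slope h x) + e)%:E)%E.
  by rewrite -{1}(fineK (slope_fin_num x)) lte_fin ltrDl.
move=> /ereal_inf_lt[_ [V xV <-] Ve].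
have /nbhs_ballP[d /= d0 dV] := xV.
near=> k.
have kd : k.+1%:R^-1 < d by near: k; exact: (near_infty_natSinv_lt (PosNum d0)).
have sk : fine (slope h x) <= dquot k.+1%:R^-1 x.
  by rewrite -lee_fin fineK ?slope_fin_num// slope_le_dquot.
rewrite distrC ger0_norm ?subr_ge0// lerBlDl.
apply: ge_sup => [|_ [y /= xy <-]];
  first by case: (@has_sup_dquot k.+1%:R^-1 x).
rewrite -lee_fin; apply: le_trans (ltW Ve); apply: ereal_sup_ubound.
by exists y => //; apply: dV; rewrite ballEmdist/=; exact: lt_trans kd.
Unshelve. all: by end_near. Qed.

Lemma slope_measurable :
  measurable_fun setT (fun x : borel X => fine (slope h x)).
Proof.
apply: (@measurable_fun_cvg _ _ _ _ (fun k => dquot k.+1%:R^-1 : borel X -> R)).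
  by move=> k; exact: dquot_measurable.
by move=> x _; exact: dquot_cvg_slope.
Qed.

End difference_quotient.

End borel_metric.

(** * Densities and entropy *)

Section finite_measure_integrals.
Context d (T : measurableType d) (R : realType) (m : {measure set T -> \bar R}).
Hypothesis mT : (m setT < +oo)%E.

Lemma bounded_integrable (M : R) (f : T -> R) : measurable_fun setT f ->
  (forall x, `|f x| <= M) -> m.-integrable setT (EFin \o f).
Proof.
move=> mf fM; apply: measurable_bounded_integrable => //.
exists M; split; first exact: num_real.
by move=> N MN x _ /=; exact: le_trans (fM x) (ltW MN).
Qed.

Lemma EFin_Rintegral (f : T -> R) : m.-integrable setT (EFin \o f) ->
  (\int[m]_x f x)%:E = (\int[m]_x (f x)%:E)%E.
Proof. by move=> fi; rewrite fineK// integrable_fin_num. Qed.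

Lemma exists_weighted_probability (g : T -> R) :
  m.-integrable setT (EFin \o g) -> (forall x, 0 <= g x) -> \int[m]_x g x = 1 ->
  exists P : probability T R, forall A, measurable A ->
    P A = (\int[m]_(x in A) (g x)%:E)%E.
Proof.
move=> gi g0 g1; pose nu A := (\int[m]_(x in A) (g x)%:E)%E.
have nu0 : nu set0 = 0%E by rewrite /nu integral_set0.
have nu_ge0 A : (0 <= nu A)%E by apply: integral_ge0 => x _; rewrite lee_fin.
have nuS : semi_sigma_additive nu.
  move=> F mF tF mUF; rewrite /nu/= integral_bigcup//; last first.
    exact: integrableS gi.
  by apply: is_cvg_ereal_nneg_natsum_cond => n _ _; exact: nu_ge0.
pose nuM := isMeasure.Build _ _ _ nu nu0 nu_ge0 nuS.
pose nu' : {measure set T -> \bar R} := HB.pack nu nuM.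
have nuT : nu' setT = 1%E by rewrite -[LHS]EFin_Rintegral// g1.
pose P : probability T R := HB.pack nu nuM (Measure_isProbability.Build _ _ _
  nu' nuT).
by exists P.
Qed.

End finite_measure_integrals.

Section lnR.
Context (R : realType).
Implicit Types x y : R.

Lemma ln_le_subr1 x : 0 < x -> ln x <= x - 1.
Proof. by move=> x0; rewrite -{1}(subrKC 1 x) le_ln1Dx// ltrBrDl subrr. Qed.

Lemma xlnx_geN1 x : 0 <= x -> -1 <= x * ln x.
Proof.
rewrite le_eqVlt => /predU1P[<-|x0]; first by rewrite mul0r.
have := @ln_le_subr1 x^-1; rewrite invr_gt0 lnV ?posrE// => /(_ x0) h.
have := ler_wpM2l (ltW x0) h; rewrite mulrBr divff ?gt_eqF// mulrN mulr1.
lra.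
Qed.

(** Convexity: the left side is the tangent line of [x * ln x] at [y]. *)
Lemma xlnx_tangent x y : 0 <= x -> 0 < y ->
  x * ln y + x - y <= x * ln x.
Proof.
rewrite le_eqVlt => /predU1P[<- y0|x0 y0]; first by rewrite !mul0r; lra.
have := @ln_le_subr1 (y / x); rewrite divr_gt0// ln_div ?posrE// => /(_ isT) h.
have := ler_wpM2l (ltW x0) h;
  rewrite !mulrBr [x * (y / x)]mulrC divfK ?gt_eqF//.
by rewrite mulr1; lra.
Qed.

Lemma lnX2 x : 0 < x -> ln (x ^+ 2) = 2 * ln x.
Proof. by move=> x0; rewrite lnXn// mulr_natl. Qed.

End lnR.

Section entropy.
Context (R : realType) (X : completeMetricType R)
  (m : {sigma_finite_measure set (borel X) -> \bar R}).
Hypothesis m1 : m setT = 1%E.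
Implicit Types P Q : probability (borel X) R.

Let mT : (m setT < +oo)%E. Proof. by rewrite m1 ltry. Qed.

Let PT P : (P setT < +oo)%E. Proof. by rewrite probability_setT ltry. Qed.

Section dominated.
Variable P : probability (borel X) R.
Hypothesis Pm : P `<< m.

Lemma densityE x : (density m P x)%:E = Radon_Nikodym_SigmaFinite.f P m x.
Proof. by rewrite fineK//; exact: (Radon_Nikodym_SigmaFinite.f_fin_num Pm). Qed.

Lemma density_ge0 x : 0 <= density m P x.
Proof.
by rewrite -lee_fin densityE; exact: (Radon_Nikodym_SigmaFinite.f_ge0 Pm).
Qed.

Lemma density_integrable : m.-integrable setT (EFin \o density m P).
Proof.
rewrite (_ : EFin \o _ = Radon_Nikodym_SigmaFinite.f P m).
  exact: Radon_Nikodym_SigmaFinite.f_integrable.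
by apply/funext => x; exact: densityE.
Qed.

Lemma density_measurable : measurable_fun setT (density m P).
Proof. by case/integrableP : density_integrable => /measurable_EFinP. Qed.

Lemma integral_density (A : set (borel X)) : measurable A ->
  P A = (\int[m]_(x in A) (density m P x)%:E)%E.
Proof.
move=> mA; rewrite (Radon_Nikodym_SigmaFinite.f_integral Pm)//.
by apply: eq_integral => x _; rewrite densityE.
Qed.

Lemma Rintegral_density1 : \int[m]_x density m P x = 1.
Proof.
by apply: EFin_inj;
  rewrite EFin_Rintegral ?density_integrable// -integral_density//
  probability_setT.
Qed.

Lemma density_mul_integrable (M : R) (f : borel X -> R) :
  measurable_fun setT f -> (forall x, `|f x| <= M) ->
  m.-integrable setT (EFin \o (fun x => f x * density m P x)).
Proof.
move=> mf fM; apply: (@le_integrable _ _ _ _ _ _ _ (EFin \o (fun x =>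
  M * density m P x))) => //.
- by apply/measurable_EFinP; apply: measurable_funM => //;
    exact: density_measurable.
- move=> x _ /=; rewrite lee_fin !normrM; apply: ler_wpM2r => //.
  exact: le_trans (fM x) (ler_norm _).
- exact: integrableZl density_integrable.
Qed.

Lemma Rintegral_mul_density (M : R) (f : borel X -> R) :
  measurable_fun setT f -> (forall x, `|f x| <= M) ->
  \int[m]_x (f x * density m P x) = \int[P]_x f x.
Proof.
move=> mf fM; have fi := bounded_integrable (PT P) mf fM.
congr fine; rewrite -(Radon_Nikodym_change_of_variables Pm measurableT fi).
apply: ae_eq_integral => //.
- by apply/measurable_EFinP; apply: measurable_funM => //;
    exact: density_measurable.
- by apply: emeasurable_funM => //; exact/measurable_EFinP.
(* The two versions of the Radon-Nikodym derivative agree only almost everywhere. *)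
- have := ae_eq_Radon_Nikodym_SigmaFinite Pm measurableT.
  by apply: filterS => x /= H /H H'; rewrite EFinM densityE H'.
Qed.

(** [Ent] asks for integrability of the positive part only; the negative part is at most 1 and [m]
    is finite. *)
Lemma Ent_integrable : Ent m P \is a fin_num ->
  m.-integrable setT (EFin \o (fun x => density m P x * ln (density m P x))).
Proof.
rewrite /Ent; case: asboolP => [[_ Pi] _|//].
have mxln : measurable_fun setT (fun x => density m P x * ln (density m P x)).
  apply: measurable_funM; first exact: density_measurable.
  exact: measurableT_comp density_measurable.
apply: (@le_integrable _ _ _ _ _ _ _ (fun x =>
   (Num.max (density m P x * ln (density m P x)) 0)%:E + (cst 1 x)%:E)%E) => //.
- exact/measurable_EFinP.
- move=> x _; rewrite -EFinD lee_fin [leRHS]ger0_norm; last first.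
    by rewrite addr_ge0// le_max lexx orbT.
  have := xlnx_geN1 (density_ge0 x); set t := _ * _ => t1.
  by rewrite ler_norml; case: (leP t 0) => ?; rewrite /=; apply/andP; split;
    lra.
- apply: integrableD => //; apply: (bounded_integrable mT (M := 1)) => // x.
  by rewrite normr1.
Qed.

(* Gibbs' inequality: the entropy relative to exp(phi) m is nonnegative. *)
Lemma le_Ent (M : R) (phi : borel X -> R) : Ent m P \is a fin_num ->
  measurable_fun setT phi -> (forall x, `|phi x| <= M) ->
  \int[m]_x expR (phi x) = 1 -> \int[P]_x phi x <= fine (Ent m P).
Proof.
move=> Pfin mphi phiM phi1.
have xi := Ent_integrable Pfin.
have pdi := density_mul_integrable mphi phiM.
have ei : m.-integrable setT (EFin \o (fun x => expR (phi x))).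
  apply: (bounded_integrable mT (M := expR M)).
    exact: measurableT_comp mphi.
  by move=> x; rewrite ger0_norm ?expR_ge0// ler_expR (le_trans (ler_norm _)).
have -> : fine (Ent m P) = \int[m]_x (density m P x * ln (density m P x)).
  by move: Pfin; rewrite /Ent; case: asboolP.
rewrite -(Rintegral_mul_density mphi phiM) -subr_ge0 -RintegralB//.
(* Adding the difference of two integrals equal to 1 turns the integrand into the gap between
   [x * ln x] and its tangent at [expR (phi x)], which is nonnegative pointwise. *)
rewrite [leRHS](_ : _ = \int[m]_x (density m P x * ln (density m P x)
   - phi x * density m P x) +
   (\int[m]_x expR (phi x) - \int[m]_x density m P x)); last first.
  by rewrite phi1 Rintegral_density1 subrr addr0.
have ai := integrableB measurableT xi pdi.
have bi := integrableB measurableT ei density_integrable.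
rewrite -RintegralB ?density_integrable// -RintegralD//.
apply: Rintegral_ge0 => x _.
have := xlnx_tangent (density_ge0 x) (expR_gt0 (phi x)); rewrite expRK.
by rewrite [phi x * _]mulrC; lra.
Qed.

End dominated.

Section weighted.
Variables (P : probability (borel X) R) (g : borel X -> R) (M : R).
Hypotheses (mg : measurable_fun setT g) (g0 : forall x, 0 <= g x)
  (gM : forall x, g x <= M)
  (Pg : forall A, measurable A -> P A = (\int[m]_(x in A) (g x)%:E)%E).

Lemma weighted_dominated : P `<< m.
Proof.
apply/null_content_dominatesP => A mA mA0; rewrite Pg//.
by apply: null_set_integral => //; exact/measurable_EFinP/measurable_funTS.
Qed.

Lemma density_weighted : {ae m, forall x, density m P x = g x}.
Proof.
have : ae_eq m setT (EFin \o density m P) (EFin \o g).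
  apply: integral_ae_eq => //.
  - exact: (density_integrable weighted_dominated).
  - exact/measurable_EFinP.
  - by move=> A _ mA; rewrite -Pg// -(integral_density weighted_dominated).
by apply: filterS => x /(_ I) [].
Qed.

Lemma Rintegral_weighted (K : R) (f : borel X -> R) : measurable_fun setT f ->
  (forall x, `|f x| <= K) -> \int[P]_x f x = \int[m]_x (f x * g x).
Proof.
move=> mf fK; rewrite -(Rintegral_mul_density weighted_dominated mf fK).
congr fine; apply: ae_eq_integral => //.
- apply/measurable_EFinP; apply: measurable_funM => //.
  exact: (density_measurable weighted_dominated).
- by apply/measurable_EFinP; exact: measurable_funM.
- by have := density_weighted; apply: filterS => x /= ->.
Qed.

Lemma Ent_weighted : Ent m P = (\int[m]_x (g x * ln (g x)))%:E.
Proof.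
have mxln : measurable_fun setT (fun x => g x * ln (g x)).
  by apply: measurable_funM => //; exact: measurableT_comp mg.
(* The upper bound comes from [ln (g x) < g x <= M]. *)
have bxln x : -1 <= g x * ln (g x) <= M ^+ 2.
  rewrite xlnx_geN1//=; have := g0 x; rewrite le_eqVlt => /predU1P[<-|gx0].
    by rewrite mul0r sqr_ge0.
  have := ln_sublinear gx0; have := gM x; have := g0 x; nra.
have xi : m.-integrable setT (EFin \o (fun x => g x * ln (g x))).
  apply: (bounded_integrable mT mxln (M := M ^+ 2 + 1)) => x.
  by have /andP[? ?] := bxln x; rewrite ler_norml; apply/andP; split; nra.
have mdxln : measurable_fun setT (fun x => density m P x * ln (density m P x)).
  have mD := density_measurable weighted_dominated.
  by apply: measurable_funM => //; exact: measurableT_comp mD.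
rewrite EFin_Rintegral// /Ent; case: asboolP => [_|[]].
  apply: ae_eq_integral => //; [exact/measurable_EFinP..|].
  by have := density_weighted; apply: filterS => x /= ->.
split; first exact: weighted_dominated.
pose G x := (Num.max (g x * ln (g x)) 0)%:E : \bar R.
have Gi : m.-integrable setT G.
  apply: (bounded_integrable mT (M := M ^+ 2)).
    exact: measurable_maxr.
  move=> x; have /andP[? ?] := bxln x.
  rewrite ger0_norm; first by rewrite ge_max; apply/andP; split => //; nra.
  by rewrite le_max lexx orbT.
have mdG : measurable_fun setT
    (fun x => (Num.max (density m P x * ln (density m P x)) 0)%:E).
  by apply/measurable_EFinP; exact: measurable_maxr.
move/integrableP : (Gi) => [mG GT]; apply/integrableP; split => //.
rewrite (@ae_eq_integral _ _ _ _ _ (abse \o G))//; [exact: measurableT_comp..|].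
by have := density_weighted; apply: filterS => x /= ->.
Qed.

End weighted.
End entropy.

(** * Couplings *)

Section transport.
Context (R : realType) (X : completeMetricType R).
Implicit Types mu nu : probability (borel X) R.

Lemma coupling_integral mu nu g (M : R) (f : borel X -> R) :
  coupling mu nu g -> measurable_fun setT f -> (forall x, `|f x| <= M) ->
  \int[g]_z f z.1 = \int[mu]_x f x /\ \int[g]_z f z.2 = \int[nu]_x f x.
Proof.
move=> gc mf fM.
have gT : (g setT < +oo)%E by rewrite probability_setT ltry.
have aux (pr : borel X * borel X -> borel X) (la : probability (borel X) R) :
    measurable_fun setT pr -> (forall A, measurable A ->
      g (pr @^-1` A) = la A) ->
    \int[g]_z f (pr z) = \int[la]_x f x.
  move=> mpr gla; congr fine.
  rewrite -(@integral_pushforward _ _ _ _ _ pr mpr g setT (EFin \o f))//.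
  - by apply: eq_measure_integral => A mA _; exact: gla.
  - exact/measurable_EFinP.
  - rewrite preimage_setT.
    apply: (bounded_integrable gT (f := f \o pr) (M := M)) => [|x];
      last exact: fM.
    exact: measurableT_comp mpr.
split; apply: aux => // A mA; have [h1 h2] := gc A mA.
- by rewrite -h1; congr (g _); apply/seteqP; split => z /=; tauto.
- by rewrite -h2; congr (g _); apply/seteqP; split => z /=; tauto.
Qed.

Lemma W2_ge0 mu nu : (0 <= W2 mu nu)%E.
Proof. exact: sqrte_ge0. Qed.

(** Couplings with cost arbitrarily close to the infimum replace an optimal one; the loss from [w]
    to [v] is removed at the very end of the endpoint argument. *)
Lemma W2_lt_coupling mu nu (w v : R) : W2 mu nu = w%:E -> w < v ->
  exists2 g, coupling mu nu g &
    (\int[g]_z ((mdist (z.1 : X) (z.2 : X)) ^+ 2)%:E <= (v ^+ 2)%:E)%E.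
Proof.
move=> Ww wv; set S := [set \int[g]_z ((mdist (z.1 : X) (z.2 : X)) ^+ 2)%:E
  | g in coupling mu nu]%E.
have w0 : 0 <= w by rewrite -lee_fin -Ww W2_ge0.
have S0 : (0 <= ereal_inf S)%E.
  apply: le_ereal_inf_tmp => _ [g _ <-]; apply: integral_ge0 => z _.
  by rewrite lee_fin sqr_ge0.
have : (ereal_inf S < (v ^+ 2)%:E)%E.
  rewrite -(sqr_sqrte S0) -[sqrte _]/(W2 mu nu) Ww -EFin_expe lte_fin.
  by rewrite ltr_pXn2r// nnegrE// (le_trans w0)// ltW.
by move=> /ereal_inf_lt[_ [g gc <-] /ltW]; exists g.
Qed.

(** The easy half of Kantorovich duality: integrate the pointwise bound against the coupling and
    read off the marginals. *)
Lemma transport_bound mu nu g (a C M M' : R) (phi p : borel X -> R) :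
  separable X -> coupling mu nu g -> 0 <= a ->
  (\int[g]_z ((mdist (z.1 : X) (z.2 : X)) ^+ 2)%:E <= C%:E)%E ->
  measurable_fun setT phi -> (forall x, `|phi x| <= M) ->
  measurable_fun setT p -> (forall x, `|p x| <= M') ->
  (forall x y, phi x - phi y <= a * (mdist (x : X) (y : X)) ^+ 2 + p x) ->
  \int[mu]_x phi x - \int[nu]_x phi x <= a * C + \int[mu]_x p x.
Proof.
move=> sX gc a0 gC mphi phiM mp pM phip.
have gT : (g setT < +oo)%E by rewrite probability_setT ltry.
have [<- <-] := coupling_integral gc mphi phiM;
  have [<- _] := coupling_integral gc mp pM.
pose D z : R := (mdist ((z : borel X * borel X).1 : X) (z.2 : X)) ^+ 2.
have mD : measurable_fun setT D by apply: measurable_funX;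
  exact: prod_mdist_measurable.
have Di : g.-integrable setT (EFin \o D).
  apply/integrableP; split; first exact/measurable_EFinP.
  under eq_integral do rewrite /= ger0_norm ?sqr_ge0//.
  exact: le_lt_trans gC (ltry _).
have i1 : g.-integrable setT (EFin \o (fun z => phi z.1)).
  by apply: (bounded_integrable gT (M := M)) => //;
    exact: measurableT_comp mphi _.
have i2 : g.-integrable setT (EFin \o (fun z => phi z.2)).
  by apply: (bounded_integrable gT (M := M)) => //;
    exact: measurableT_comp mphi _.
have ip : g.-integrable setT (EFin \o (fun z => p z.1)).
  by apply: (bounded_integrable gT (M := M')) => //;
    exact: measurableT_comp mp _.
have aDi : g.-integrable setT (EFin \o (fun z => a * D z)).
  exact: (integrableZl measurableT a Di).
have DC : \int[g]_z D z <= C by rewrite -lee_fin EFin_Rintegral.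
apply: (@le_trans _ _ (a * \int[g]_z D z + \int[g]_z p z.1)); last first.
  by rewrite lerD2r ler_wpM2l.
rewrite -RintegralB// -RintegralZl// -RintegralD//.
apply: le_Rintegral => //; first exact: (integrableB measurableT i1 i2).
exact: (integrableD measurableT aDi ip).
Qed.

End transport.

Lemma young_mul (R : realFieldType) (al q d : R) : 0 < al ->
  q * d <= al / 2 * d ^+ 2 + q ^+ 2 / (2 * al).
Proof.
move=> al0; rewrite -subr_ge0.
rewrite (_ : _ - _ = (al * d - q) ^+ 2 / (2 * al)).
  by rewrite divr_ge0 ?sqr_ge0 ?mulr_ge0// ltW.
by field; lra.
Qed.

(** * Integrals of squared slopes and difference quotients *)

Section dquot_integral.
Context (R : realType) (X : completeMetricType R)
  (m : {measure set (borel X) -> \bar R}).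
Hypothesis mT : (m setT < +oo)%E.
Variables (L : R) (h : X -> R).
Hypotheses (L0 : 0 <= L) (hL : lipschitz_bound L h).

Lemma slope_sqr_integrable :
  m.-integrable setT (EFin \o (fun x : borel X => fine (slope h x) ^+ 2)).
Proof.
apply: (bounded_integrable mT (M := L ^+ 2)).
  apply: measurable_funX; exact: (slope_measurable L0 hL).
move=> x; rewrite ger0_norm ?sqr_ge0// ler_pXn2r ?nnegrE ?fine_ge0 ?slope_ge0//.
by rewrite -lee_fin (fineK (slope_fin_num L0 hL x)) (slope_le L0 hL).
Qed.

Lemma dquot_sqr_integrable r : 0 < r ->
  m.-integrable setT (EFin \o (fun x : borel X => dquot h r x ^+ 2)).
Proof.
move=> r0; apply: (bounded_integrable mT (M := L ^+ 2)).
  apply: measurable_funX; exact: (dquot_measurable L0 hL).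
move=> x; rewrite ger0_norm ?sqr_ge0// ler_pXn2r ?nnegrE//.
- exact: (dquot_le L0 hL).
- exact: (dquot_ge0 L0 hL).
Qed.

Lemma Rintegral_slope_sqr :
  (\int[m]_x (slope h x) ^+ 2)%E = (\int[m]_x (fine (slope h x)) ^+ 2)%:E.
Proof.
rewrite EFin_Rintegral; last exact: slope_sqr_integrable.
by apply: eq_integral => x _; rewrite EFin_expe (fineK (slope_fin_num L0 hL x)).
Qed.

Lemma dquot_integral_cvg :
  (\int[m]_x (dquot h k.+1%:R^-1 x) ^+ 2) @[k --> \oo] -->
  \int[m]_x (fine (slope h x)) ^+ 2.
Proof.
have := @dominated_convergence _ _ _ m setT measurableT
  (fun k x => (dquot h k.+1%:R^-1 x ^+ 2)%:E)
  (fun x => (fine (slope h x) ^+ 2)%:E) (cst (L ^+ 2)%:E).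
case => //.
- move=> k; apply/measurable_EFinP/measurable_funX;
    exact: (dquot_measurable L0 hL).
- apply/measurable_EFinP/measurable_funX; exact: (slope_measurable L0 hL).
- apply: aeW => x _; apply: cvg_EFin; first by apply: nearW.
  rewrite /comp/=; apply: (@continuous_cvg _ R R _ _ _ (fun y : R => y ^+ 2)).
    exact: exprn_continuous.
  exact: (dquot_cvg_slope L0 hL).
- by apply: (bounded_integrable mT (f := cst (L ^+ 2)) (M := `|L ^+ 2|)) =>
    // x.
- apply: aeW => x k _; rewrite lee_fin ger0_norm ?sqr_ge0// ler_pXn2r ?nnegrE//.
  + exact: (dquot_le L0 hL).
  + exact: (dquot_ge0 L0 hL).
move=> _ _ H; apply: fine_cvg; rewrite EFin_Rintegral//;
  exact: slope_sqr_integrable.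
Qed.

End dquot_integral.

(** * Decrease of the entropy along a geodesic *)

Section short_time.
Context (R : realType) (X : completeMetricType R)
  (m : {sigma_finite_measure set (borel X) -> \bar R}).
Hypotheses (m1 : m setT = 1%E) (sX : separable X).
Variables (L c C : R) (h : X -> R).
Hypotheses (L0 : 0 <= L) (hL : lipschitz_bound L h) (c0 : 0 < c)
  (hc : forall x, c <= h x) (hC : forall x, h x <= C).
Hypothesis h1 : \int[m]_x (h x) ^+ 2 = 1.
Variable P : probability (borel X) R.
Hypothesis Ph : forall A, measurable A ->
  P A = (\int[m]_(x in A) ((h x) ^+ 2)%:E)%E.

Let mT : (m setT < +oo)%E. Proof. by rewrite m1 ltry. Qed.

Let h0 x : 0 < h x. Proof. exact: lt_le_trans c0 (hc x). Qed.

Let phi (x : borel X) : R := ln (h x ^+ 2).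

Let mh : measurable_fun setT (h : borel X -> R).
Proof. by apply: lipschitz_measurable; exists L. Qed.

Let mh2 : measurable_fun setT (fun x : borel X => h x ^+ 2).
Proof. exact: measurable_funX. Qed.

Let h2C (x : borel X) : h x ^+ 2 <= C ^+ 2.
Proof.
rewrite ler_pXn2r// nnegrE; first exact: ltW.
exact: le_trans (ltW (h0 x)) (hC x).
Qed.

Let mphi : measurable_fun setT phi.
Proof. exact: measurableT_comp mh2. Qed.

Let Mphi := `|ln (c ^+ 2)| + `|ln (C ^+ 2)|.

Let phiM x : `|phi x| <= Mphi.
Proof.
have c2 : ln (c ^+ 2) <= phi x.
  rewrite ler_ln// ?posrE ?exprn_gt0// ler_pXn2r// nnegrE ltW//.
have C2 : phi x <= ln (C ^+ 2).
  by rewrite ler_ln// posrE exprn_gt0// (lt_le_trans (h0 x)).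
rewrite ler_norml /Mphi; have := ler_norm (ln (C ^+ 2)).
have := ler_norm (- ln (c ^+ 2)); rewrite normrN.
have := normr_ge0 (ln (C ^+ 2)); have := normr_ge0 (ln (c ^+ 2)).
by move=> *; apply/andP; split; lra.
Qed.

Lemma ln_sqr_sub_le x y : phi x - phi y <= 2 * ((h x - h y) / h y).
Proof.
have hxy : 0 < h x / h y by rewrite divr_gt0.
rewrite /phi !lnX2// -mulrBr -ln_div ?posrE// ler_wpM2l//.
apply: le_trans (ln_le_subr1 hxy) _.
by rewrite mulrBl divff// gt_eqF.
Qed.

Lemma ln_sqr_sub_le_lip x y : phi x - phi y <= 2 * L / c * mdist x y.
Proof.
apply: le_trans (ln_sqr_sub_le x y) _.
rewrite (_ : 2 * L / c * _ = 2 * (L * mdist x y / c)); last by ring.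
rewrite ler_wpM2l//; apply: (@le_trans _ _ (L * mdist x y / h y)).
  rewrite ler_wpM2r ?invr_ge0 ?(ltW (h0 y))//.
  by have := hL x y; rewrite ler_norml => /andP[].
by rewrite ler_wpM2l ?mulr_ge0 ?mdist_ge0// lef_pV2 ?posrE.
Qed.

(** The bound by [h y] in the denominator is moved to [h x]: within distance [r], [h x <= h y + L *
    r <= h y * (1 + L * r / c)], as [h y >= c]. *)
Lemma ln_sqr_sub_le_dquot r x y : 0 < r -> mdist x y < r ->
  phi x - phi y <= 2 * (1 + L * r / c) * (dquot h r x / h x) * mdist x y.
Proof.
move=> r0 xyr; apply: le_trans (ln_sqr_sub_le x y) _.
rewrite -!mulrA ler_wpM2l// ler_pdivrMr//.
have hxy : h x - h y <= dquot h r x * mdist x y.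
  by apply: le_trans (ler_dist_dquot L0 hL xyr); rewrite distrC ler_norm.
apply: le_trans hxy _.
have q0 := dquot_ge0 L0 hL x r0; have d0 := mdist_ge0 x y.
rewrite (_ : (1 + L * (r / c)) * (dquot h r x * ((h x)^-1 * mdist x y)) * h y
  = dquot h r x * mdist x y * ((1 + L * (r / c)) * (h y / h x))); last by ring.
rewrite -[leLHS]mulr1 ler_wpM2l ?mulr_ge0// mulrA ler_pdivlMr// mul1r.
have := hL x y; rewrite ler_norml => /andP[_ hxy].
have : L * mdist x y <= L * r by rewrite ler_wpM2l// ltW.
have : L * r <= L * (r / c) * h y.
  rewrite mulrA -mulrA ler_peMr ?mulr_ge0 ?(ltW r0)//.
  by rewrite mulrC ler_pdivlMr// mul1r.
by rewrite mulrDl mul1r; lra.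
Qed.

Lemma Ent_weighted_sqr : Ent m P = (\int[P]_x phi x)%:E.
Proof.
rewrite (Ent_weighted m1 mh2 _ h2C Ph); last by move=> x; exact: sqr_ge0.
rewrite (Rintegral_weighted mh2 Ph mphi phiM).
by congr EFin; apply: eq_Rintegral => x _; rewrite mulrC.
Qed.

(** Integrated form of the bound on the entropy derivative: [s] lies just above the square root of
    the Fisher information of [P] and [V] just above the distance from [P] to [mu_ 1]. *)
Lemma Ent_short_time (mu_ : R -> probability (borel X) R) (W V s : R) :
  W2_geodesic mu_ -> mu_ 0 = P -> W2 P (mu_ 1) = W%:E -> W < V -> 0 < s ->
  4 * \int[m]_x (fine (slope h x)) ^+ 2 < s ^+ 2 ->
  exists2 t0, 0 < t0 & forall t, 0 < t < t0 -> t <= 1 ->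
    Ent m (mu_ t) \is a fin_num ->
    fine (Ent m P) - fine (Ent m (mu_ t)) <= t * (s * V).
Proof.
move=> geo mu0 PW WV s0 Is.
have W0 : 0 <= W by rewrite -lee_fin -PW W2_ge0.
have V0 : 0 < V := le_lt_trans W0 WV.
(* [J r] is the integral against [P] of the square of the factor [q] below, the weight [h ^+ 2]
   cancelling the division by [h]. Its limit as the radius shrinks is below [s ^+ 2], which fixes a
   radius. *)
pose J r := (2 * (1 + L * r / c)) ^+ 2 * \int[m]_x (dquot h r x) ^+ 2.
have Jcvg : J k.+1%:R^-1 @[k --> \oo] --> 4 * \int[m]_x (fine (slope h x)) ^+ 2.
  apply: cvgM; last exact: (dquot_integral_cvg mT L0 hL).
  have c1 : 2 * (1 + L * k.+1%:R^-1 / c) @[k --> \oo] --> (2 : R).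
    rewrite -[X in _ --> X]mulr1; apply: cvgMr.
    rewrite -[X in _ --> X]addr0; apply: cvgD; first exact: cvg_cst.
    rewrite -(mul0r c^-1); apply: cvgMl.
    rewrite -(mulr0 L); apply: cvgMr; exact: cvg_harmonic.
  rewrite (_ : 4 = 2 ^+ 2); last by rewrite -natrX.
  apply: (@continuous_cvg _ R R _ _ _ (fun y : R => y ^+ 2)) c1.
  exact: exprn_continuous.
have [k Jk] : exists k, J k.+1%:R^-1 < s ^+ 2.
  have := cvgr_lt _ Jcvg _ Is; case=> n _ /(_ n (leqnn n)) ?.
  by exists n.
set r := k.+1%:R^-1 in Jk.
have r0 : 0 < r by rewrite invr_gt0.
clearbody r.
(* The bound on [t] makes the contribution of distant pairs, at most [t * K / r ^+ 2] for [t <= 1],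
   smaller than [s ^+ 2 - J r]. The extra 1 keeps [K] positive when [L = 0]. *)
pose K := V ^+ 2 * (2 * L / c) ^+ 2 + 1.
have K0 : 0 < K by rewrite ltr_wpDl// mulr_ge0 ?sqr_ge0.
exists ((s ^+ 2 - J r) * r ^+ 2 / K) => [|t /andP[t0 tlt] t1 mutfin].
  by rewrite divr_gt0 ?mulr_gt0 ?subr_gt0 ?exprn_gt0.
have PT : W2 P (mu_ t) = (t * W)%:E.
  have := geo 0 t; rewrite lexx ler01 (ltW t0) t1 => /(_ isT isT).
  by rewrite mu0 PW subr0 gtr0_norm.
have [|g gc gC] := @W2_lt_coupling _ _ _ _ _ (t * V) PT.
  by rewrite ltr_pM2l.
have mutm : mu_ t `<< m by move: mutfin; rewrite /Ent; case: asboolP => [[]|].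
have Gibbs := le_Ent m1 mutm mutfin mphi phiM.
have {}Gibbs : \int[mu_ t]_x phi x <= fine (Ent m (mu_ t)).
  apply: Gibbs; rewrite -[RHS]h1; apply: eq_Rintegral => x _.
  by rewrite /phi lnK// posrE exprn_gt0.
rewrite Ent_weighted_sqr [fine (EFin _)]/=.
apply: (@le_trans _ _ (\int[P]_x phi x - \int[mu_ t]_x phi x)).
  by rewrite lerD2l lerN2.
(* This weight minimises [al / 2 * (t * V) ^+ 2 + s ^+ 2 / (2 * al)], and the minimum is
   [t * (s * V)]. *)
have [al alE] : exists al, al = s / (V * t) by exists (s / (V * t)).
have al0 : 0 < al by rewrite alE divr_gt0 ?mulr_gt0.
have al2 : 0 <= 2 * al by rewrite mulr_ge0// ltW.
pose q (x : borel X) := 2 * (1 + L * r / c) * (dquot h r x / h x).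
(* Young's inequality with weight al stands in for the Cauchy-Schwarz inequality;
   pairs at distance >= r are paid for by the squared distance. *)
pose p (x : borel X) := q x ^+ 2 / (2 * al).
pose a := al / 2 + (2 * L / c) ^+ 2 / (2 * al) / r ^+ 2.
have mq : measurable_fun setT q.
  apply: measurable_funM => //.
  have md := dquot_measurable L0 hL r0.
  under eq_fun => x do rewrite -[dquot h r x / h x]/(dquot h r x * (h x)^-1)
    -powR_inv1 ?(ltW (h0 x))//.
  apply: measurable_funM => //.
  exact: measurableT_comp (measurable_powR _) mh.
pose Q := 2 * (1 + L * r / c) * (L / c).
have q0 x : 0 <= q x.
  rewrite /q !mulr_ge0 ?addr_ge0 ?mulr_ge0 ?invr_ge0 ?(ltW r0) ?(ltW c0) ?(ltW
    (h0 x))//.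
  exact: (dquot_ge0 L0 hL).
have qQ x : q x <= Q.
  rewrite /q /Q ler_wpM2l//.
    by rewrite !mulr_ge0 ?addr_ge0 ?mulr_ge0 ?invr_ge0 ?(ltW r0) ?(ltW c0).
  apply: ler_pM; rewrite ?invr_ge0 ?(ltW (h0 x))//.
  - exact: (dquot_ge0 L0 hL).
  - exact: (dquot_le L0 hL).
  - by rewrite lef_pV2 ?posrE.
have pQ x : `|p x| <= Q ^+ 2 / (2 * al).
  rewrite /p ger0_norm ?divr_ge0 ?sqr_ge0 ?al2 ?(ltW al0)//.
  rewrite ler_wpM2r ?invr_ge0 ?al2 ?(ltW al0)//.
  by rewrite ler_pXn2r// nnegrE// (le_trans (q0 x)).
have mp : measurable_fun setT p.
  by apply: measurable_funM => //; exact: measurable_funX.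
have a0 : 0 <= a.
  by rewrite addr_ge0 ?divr_ge0 ?sqr_ge0 ?al2 ?(ltW al0) ?(ltW r0).
have phip x y : phi x - phi y <= a * (mdist (x : X) (y : X)) ^+ 2 + p x.
  have p0 : 0 <= p x by rewrite divr_ge0 ?sqr_ge0 ?al2 ?(ltW al0).
  rewrite /a mulrDl; have [xyr|rxy] := ltP (mdist (x : X) (y : X)) r.
    apply: le_trans (ln_sqr_sub_le_dquot r0 xyr) _.
    apply: le_trans (young_mul (q x) (mdist (x : X) (y : X)) al0) _.
    rewrite -/(p x) lerD2r lerDl mulr_ge0 ?sqr_ge0//.
    by rewrite !divr_ge0 ?sqr_ge0 ?al2 ?(ltW al0).
  apply: le_trans (ln_sqr_sub_le_lip x y) _.
  apply: le_trans (young_mul _ (mdist (x : X) (y : X)) al0) _.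
  rewrite -addrA lerD2l;
    apply: le_trans (_ : _ <= (2 * L / c) ^+ 2 / (2 * al) / r ^+ 2 *
      mdist (x : X) (y : X) ^+ 2) _; last by rewrite lerDl.
  have Z0 : 0 <= (2 * L / c) ^+ 2 / (2 * al) by rewrite divr_ge0 ?sqr_ge0.
  have mulrdiv (z u v : R) : z / u * v = z * (v / u) by rewrite mulrAC mulrA.
  rewrite [leRHS]mulrdiv ler_peMr//.
  rewrite ler_pdivlMr ?exprn_gt0// mul1r ler_pXn2r// nnegrE ?(ltW r0)//.
  exact: mdist_ge0.
apply: le_trans (transport_bound sX gc a0 gC mphi phiM mp pQ phip) _.
have -> : \int[P]_x p x = J r / (2 * al).
  rewrite (Rintegral_weighted mh2 Ph mp pQ).
  rewrite /J mulrAC -RintegralZl//; last exact: (dquot_sqr_integrable mT L0 hL).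
  apply: eq_Rintegral => x _; rewrite /p /q.
  by field; rewrite !gt_eqF.
have tK : t * K < (s ^+ 2 - J r) * r ^+ 2 by rewrite -ltr_pdivlMr.
have key : J r + (2 * L / c) ^+ 2 * (t * V) ^+ 2 / r ^+ 2 <= s ^+ 2.
  rewrite -lerBrDl ler_pdivrMr ?exprn_gt0//; apply: le_trans (ltW tK).
  rewrite [leLHS](_ : _ = t ^+ 2 * (V ^+ 2 * (2 * L / c) ^+ 2)); last by ring.
  have t2 : t ^+ 2 <= t by rewrite expr2 ger_pMl.
  have VK : V ^+ 2 * (2 * L / c) ^+ 2 <= K by rewrite lerDl.
  by apply: ler_pM => //; rewrite ?sqr_ge0// mulr_ge0// sqr_ge0.
rewrite [leLHS](_ : _ = t * s * V / 2 + t * V / (2 * s) *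
    (J r + (2 * L / c) ^+ 2 * (t * V) ^+ 2 / r ^+ 2)); last first.
  by rewrite /a alE; field; rewrite ?gt_eqF.
apply: (@le_trans _ _ (t * s * V / 2 + t * V / (2 * s) * s ^+ 2)).
  by rewrite lerD2l ler_wpM2l// divr_ge0 ?mulr_ge0// ltW.
rewrite [leLHS](_ : _ = t * (s * V)) ?lexx//.
by field; rewrite gt_eqF.
Qed.

End short_time.

(** * The endpoint derivative of the concavity inequality *)

Section endpoint_derivative.
Context (R : realType).

(** A negative derivative would make [F] negative just to the right of its zero at 0. *)
Lemma is_derive_right_ge0 (F : R -> R) (dF t0 : R) :
  is_derive (0 : R) (1 : R) F dF -> F 0 = 0 -> 0 < t0 -> (forall t, 0 < t < t0 -> 0 <= F t) -> 0 <= dF.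
Proof.
move=> FdF F0 t00 Fge; rewrite leNgt; apply/negP => dF0.
have [dv dE] := FdF.
have := dv; rewrite /derivable => /cvg_ex[l /= hl].
have El : l = dF by rewrite -dE; apply/esym/cvg_lim.
have [e /= e0 he] := cvgr_lt _ hl 0 ltac:(by rewrite El).
pose t := Num.min e t0 / 2.
have mt0 : 0 < Num.min e t0 by rewrite lt_min e0.
have t_gt0 : 0 < t by rewrite divr_gt0.
have tm : t < Num.min e t0 by rewrite ltr_pdivrMr// mulr2n mulrDr mulr1 ltrDl.
have /andP[te tt0] : (t < e) && (t < t0) by rewrite -lt_min.
have := he t; rewrite /= sub0r normrN gtr0_norm// => /(_ te (lt0r_neq0 t_gt0)).
rewrite F0 subr0 scaler1 addr0 ltNge => /negP; apply.
by apply: mulr_ge0; [rewrite invr_ge0 ltW|rewrite Fge// t_gt0].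
Qed.

Lemma sin_endpoint (u B th t0 : R) : 0 < th < pi -> 0 < t0 ->
  (forall t, 0 < t < t0 ->
    sin (th * (1 - t)) / sin th * u + sin (th * t) / sin th
     <= u * expR (t * B)) ->
  th <= u * (th * cos th + sin th * B).
Proof.
move=> thpi t00 hF; have s0 : 0 < sin th by apply: sin_gt0_pi.
pose F t := u * expR (t * B) -
  (sin (th * (1 - t)) / sin th * u + sin (th * t) / sin th).
have FD : is_derive (0 : R) (1 : R) F
    (u * B + (th * cos th / sin th * u - th / sin th)).
  apply: is_derive_eq.
  rewrite /GRing.scale/=.
  rewrite !(mul0r, mulr0, subr0, addr0, mulr1, mul1r, add0r, sub0r, expR0,
    cos0).
  by ring.
have F0 : F 0 = 0.
  by rewrite /F mul0r expR0 mulr0 sin0 subr0 !mulr1 divff ?gt_eqF//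
    mul0r mul1r addr0 subrr.
have := is_derive_right_ge0 FD F0 t00.
have Fge t : 0 < t < t0 -> 0 <= F t by move=> /hF; rewrite /F subr_ge0.
move=> /(_ Fge); rewrite (_ : _ + _ =
    (u * (th * cos th + sin th * B) - th) / sin th).
  by rewrite pmulr_lge0 ?invr_gt0// subr_ge0.
by field; rewrite gt_eqF.
Qed.

Lemma lin_endpoint (u B t0 : R) : 0 < t0 ->
  (forall t, 0 < t < t0 -> (1 - t) * u + t <= u * expR (t * B)) ->
  1 <= u * (1 + B).
Proof.
move=> t00 hF; pose F t := u * expR (t * B) - ((1 - t) * u + t).
have FD : is_derive (0 : R) (1 : R) F (u * (1 + B) - 1).
  apply: is_derive_eq.
  rewrite /GRing.scale/=.
  rewrite !(mul0r, mulr0, subr0, addr0, mulr1, mul1r, add0r, sub0r, expR0,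
    cos0).
  by ring.
have F0 : F 0 = 0 by rewrite /F mul0r expR0 mulr1 subr0 mul1r addr0 subrr.
have Fge t : 0 < t < t0 -> 0 <= F t by move=> /hF; rewrite /F subr_ge0.
by have := is_derive_right_ge0 FD F0 t00 Fge; rewrite subr_ge0.
Qed.

Definition rsigma (kappa t r : R) : R :=
  if r == 0 then t else sin (Num.sqrt kappa * t * r) / sin (Num.sqrt kappa * r).

(** Here [u] stands for the value of [U] at the starting measure, the value at the endpoint being 1.
    Differentiating at 0 and letting [V] decrease to [W] bounds [u^-1] by a combination of [cos th]
    and [sin th]. For [W = 0] the linear version gives [u >= 1], and the left side is at most 0. *)
Lemma rsigma_endpoint (K N u s W : R) : 0 < K -> 0 < N -> 0 < u -> 0 < s ->
  0 <= W -> K / N * W ^+ 2 < pi ^+ 2 ->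
  (forall V, W < V -> exists2 t0, 0 < t0 & forall t, 0 < t < t0 ->
    rsigma (K / N) (1 - t) W * u + rsigma (K / N) t W <=
      u * expR (t * (s * V / N))) ->
  K * N * (u ^-2 - 1) <= s ^+ 2.
Proof.
move=> K0 N0 u0 s0; rewrite le_eqVlt => /predU1P[<- _ h|W0 Wpi h].
  have u1 : 1 <= u.
    apply/ler_addgt0Pl => e e0.
    (* This choice of [V] makes the excess of [u * (1 + s * V / N)] over [u] equal to [e]. *)
    have e'0 : 0 < e * N / (u * s) by rewrite divr_gt0 ?mulr_gt0.
    have [t0 t00 ht] := h _ e'0.
    rewrite [leRHS](_ : _ = u * (1 + s * (e * N / (u * s)) / N)).
      by apply: (lin_endpoint t00) => t /ht; rewrite /rsigma eqxx.
    by field; rewrite !gt_eqF.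
  have : u ^-2 <= 1 by rewrite invf_le1 ?exprn_gt0// exprn_ege1.
  have := mulr_gt0 K0 N0; have := sqr_ge0 s; nra.
have Wn0 : W == 0 = false by rewrite gt_eqF.
set k := Num.sqrt (K / N) in h; pose th := k * W.
have k0 : 0 < k by rewrite sqrtr_gt0 divr_gt0.
have k2 : k ^+ 2 = K / N by rewrite sqr_sqrtr// ltW// divr_gt0.
have th0 : 0 < th by rewrite mulr_gt0.
have thpi : th < pi.
  by rewrite -(ltr_pXn2r (n := 2))// ?nnegrE ?pi_ge0 ?(ltW th0)// exprMn k2.
have sin0 : 0 < sin th by apply: sin_gt0_pi; rewrite th0.
have main V : W < V -> th <= u * (th * cos th + sin th * (s * V / N)).
  move=> /h[t0 t00 ht]; apply: (@sin_endpoint _ _ _ t0);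
    rewrite ?th0// => t /ht.
  by rewrite /rsigma Wn0 -/k -/th (mulrAC _ t) (mulrAC _ (1 - t)).
have mainW : th <= u * (th * cos th + sin th * (s * W / N)).
  apply/ler_addgt0Pl => e e0.
  (* Raising [V] by this amount raises the right side of [main] by exactly [e]. *)
  have e'0 : 0 < e * N / (u * sin th * s) by rewrite divr_gt0 ?mulr_gt0.
  have := main (W + e * N / (u * sin th * s)); rewrite ltrDl => /(_ e'0).
  move=> /le_trans; apply; rewrite le_eqVlt; apply/orP; left; apply/eqP.
  by field; rewrite !gt_eqF.
(* Dividing [mainW] by [u * th] leaves the coefficient [s * W / (N * th)] of [sin th], and
   [th = k * W]. *)
pose b := s / (k * N).
have b2 : K * N * b ^+ 2 = s ^+ 2.
  rewrite /b expr_div_n exprMn k2; field; rewrite !gt_eqF//.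
have iu : u^-1 <= cos th + sin th * b.
  rewrite -[leLHS]mul1r ler_pdivrMr// mulrC -(ler_pM2r th0) mul1r.
  apply: le_trans mainW _; rewrite le_eqVlt; apply/orP; left; apply/eqP.
  by rewrite /b /th; field; rewrite !gt_eqF.
have cs : (cos th + sin th * b) ^+ 2 <= 1 + b ^+ 2.
  (* Cauchy-Schwarz for [(cos th, sin th)] and [(1, b)], through Lagrange's identity. *)
  rewrite -subr_ge0 (_ : _ - _ = (sin th - cos th * b) ^+ 2) ?sqr_ge0//.
  have := cos2Dsin2 th; set c := cos th; set d := sin th => cd.
  have -> : 1 + b ^+ 2 = (c ^+ 2 + d ^+ 2) * (1 + b ^+ 2) by rewrite cd mul1r.
  by ring.
have u2 : u ^-2 <= 1 + b ^+ 2.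
  apply: le_trans cs; rewrite -exprVn ler_pXn2r// nnegrE ?invr_ge0 ?(ltW u0)//.
  by apply: le_trans iu; rewrite invr_ge0 ltW.
by rewrite -b2 ler_wpM2l ?lerBlDl// mulr_ge0 ?ltW.
Qed.

End endpoint_derivative.

(** * Densities bounded away from 0 and infinity *)

Section bounded_lipschitz.
Context (R : realType) (X : completeMetricType R)
  (m : {sigma_finite_measure set (borel X) -> \bar R}) (K N : R).
Hypotheses (m1 : m setT = 1%E) (sX : separable X) (m2 : P2 m).
Hypotheses (K0 : 0 < K) (N0 : 0 < N) (cde : CDe m K N).

Let mT : (m setT < +oo)%E. Proof. by rewrite m1 ltry. Qed.

Lemma P2_weighted (P : probability (borel X) R) (g : borel X -> R) (M : R) :
  measurable_fun setT g -> (forall x, g x <= M) ->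
  (forall A, measurable A -> P A = (\int[m]_(x in A) (g x)%:E)%E) ->
  P2 P.
Proof.
move=> mg gM Pg; split; first exact: probability_setT.
have Pm := weighted_dominated mg Pg.
have [_ [x0 d2]] := m2; exists x0.
have md : measurable_fun setT (fun x : borel X => (mdist x0 (x : X) ^+ 2)%:E).
  by apply/measurable_EFinP/measurable_funX; exact: mdist_measurable.
rewrite -(Radon_Nikodym_SigmaFinite.change_of_variables Pm)//; last first.
  by move=> x; rewrite lee_fin sqr_ge0.
apply: (@le_lt_trans _ _ (\int[m]_x (`|M|%:E * (mdist x0 (x : X) ^+ 2)%:E))%E).
  rewrite (@ae_eq_integral _ _ _ _ _ (fun x : borel X =>
    (mdist x0 (x : X) ^+ 2 * density m P x)%:E))//.
  - apply: ae_ge0_le_integral => //.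
    + by move=> x _; rewrite lee_fin mulr_ge0 ?sqr_ge0 ?(density_ge0 Pm).
    + apply/measurable_EFinP; apply: measurable_funM.
        by apply: measurable_funX; exact: mdist_measurable.
      exact: (density_measurable Pm).
    + by move=> x _; rewrite mule_ge0// lee_fin sqr_ge0.
    + exact: measurable_funeM.
    + have := density_weighted mg Pg; apply: filterS => x /= -> _.
      rewrite lee_fin mulrC ler_wpM2r ?sqr_ge0//.
      by rewrite (le_trans (gM x))// ler_norm.
  - apply: emeasurable_funM => //.
    by apply: measurable_int;
      exact: (Radon_Nikodym_SigmaFinite.f_integrable Pm).
  - apply/measurable_EFinP; apply: measurable_funM.
      by apply: measurable_funX; exact: mdist_measurable.
    exact: (density_measurable Pm).
  - by apply: aeW => x _; rewrite EFinM (densityE Pm).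
rewrite ge0_integralZl//; last by move=> x _; rewrite lee_fin sqr_ge0.
by rewrite lte_mul_pinfty// lee_fin.
Qed.

(** [CDe] speaks of bundled probabilities, so [m] is rebuilt as the one with density 1. *)
Lemma exists_reference_probability : exists2 Q : probability (borel X) R,
  P2star m Q & Ent m Q = 0%E.
Proof.
have gi : m.-integrable setT (EFin \o cst (1 : R)).
  by apply: (bounded_integrable mT (M := 1)) => // x; rewrite normr1.
have I1 : \int[m]_x cst (1 : R) x = 1 by rewrite Rintegral_cst// mul1r;
  exact: (congr1 fine m1).
have [Q Qg] := exists_weighted_probability gi (fun=> ler01) I1.
have EQ : Ent m Q = 0%E.
  rewrite (Ent_weighted m1 _ _ _ Qg (M := 1))//=.
  by rewrite ln1 mulr0 Rintegral_cst// mul0r.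
exists Q => //; split; last by rewrite EQ.
exact: (P2_weighted _ _ Qg (M := 1)).
Qed.

Lemma sigma_fin (t r : R) : K / N * r ^+ 2 < pi ^+ 2 ->
  sigma (K / N) t r%:E = (rsigma (K / N) t r)%:E.
Proof. by move=> rpi; rewrite /sigma /rsigma rpi; case: ifPn. Qed.

Lemma sigma_fin_or_top (t : R) (theta : \bar R) : (0 <= theta)%E ->
  (exists2 r, theta = r%:E & K / N * r ^+ 2 < pi ^+ 2) \/
  sigma (K / N) t theta = +oo%E.
Proof.
case: theta => [r r0| _ |//]; last by right.
have [rpi|rpi] := boolP (K / N * r ^+ 2 < pi ^+ 2); first by left; exists r.
right; rewrite /sigma (negbTE rpi); case: eqP rpi => [->|//].
by rewrite expr0n/= mulr0 exprn_gt0// pi_gt0.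
Qed.

Lemma U_fin (mu : probability (borel X) R) (e : R) : Ent m mu = e%:E ->
  U m N mu = (expR (- (N^-1 * e)))%:E.
Proof. by move=> E; rewrite /U E. Qed.

(** [Ent_short_time] turns the concavity inequality along the geodesic from [P] to [Q] into the
    hypothesis of [rsigma_endpoint]. *)
Lemma log_sobolev_lipschitz (L c C : R) (h : X -> R) :
  0 <= L -> lipschitz_bound L h -> 0 < c -> (forall x, c <= h x) ->
  (forall x, h x <= C) -> \int[m]_x (h x) ^+ 2 = 1 ->
  K * N * (expR (2 / N * \int[m]_x ((h x) ^+ 2 * ln ((h x) ^+ 2))) - 1) <=
  4 * \int[m]_x (fine (slope h x)) ^+ 2.
Proof.
move=> L0 hL c0 hc hC h1.
have h0 x : 0 < h x := lt_le_trans c0 (hc x).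
have mh : measurable_fun setT (h : borel X -> R).
  by apply: lipschitz_measurable; exists L.
have mh2 : measurable_fun setT (fun x : borel X => h x ^+ 2).
  exact: measurable_funX.
have h2C (x : borel X) : h x ^+ 2 <= C ^+ 2.
  rewrite ler_pXn2r// nnegrE; first exact: ltW.
  exact: le_trans (ltW (h0 x)) (hC x).
have h20 (x : borel X) : 0 <= h x ^+ 2 by exact: sqr_ge0.
have hi : m.-integrable setT (EFin \o (fun x : borel X => h x ^+ 2)).
  by apply: (bounded_integrable mT mh2 (M := C ^+ 2)) => x; rewrite ger0_norm.
have [P Ph] := exists_weighted_probability hi h20 h1.
set E := \int[m]_x _.
have EP : Ent m P = E%:E := Ent_weighted m1 mh2 h20 h2C Ph.
have P2P : P2star m P by split; [exact: (P2_weighted mh2 h2C Ph)|rewrite EP].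
have [Q P2Q EQ] := exists_reference_probability.
have [mu_ [mu0 mu1 geo mut]] := cde P2P P2Q.
have UP := U_fin EP; have UQ := U_fin EQ.
rewrite mulr0 oppr0 expR0 in UQ.
set u := expR _ in UP.
have u0 : 0 < u by exact: expR_gt0.
(* A diameter bound of Bonnet-Myers type: beyond it both coefficients at the midpoint are infinite,
   while [U] is finite there because the entropy is. *)
have [W PW Wpi] : exists2 W, W2 P Q = W%:E & K / N * W ^+ 2 < pi ^+ 2.
  have h2 : 0 <= (2^-1 : R) <= 1 by rewrite invr_ge0 ler0n/= invf_le1 ?ler1n.
  have [//|s1] := @sigma_fin_or_top (1 - 2^-1) _ (W2_ge0 P Q).
  have [//|s2] := @sigma_fin_or_top 2^-1 _ (W2_ge0 P Q).
  have [[_ Efin] +] := mut _ h2; rewrite s1 s2 UP UQ.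
  rewrite gt0_mulye ?lte_fin// mule1 /=.
  by rewrite (U_fin (esym (fineK Efin))).
have W0 : 0 <= W by rewrite -lee_fin -PW W2_ge0.
(* The slack [e] provides the strict inequality required of [s] and keeps [s] positive even if the
   slope of [h] vanishes almost everywhere. *)
apply/ler_addgt0Pl => e e0.
set I := \int[m]_x (fine (slope h x)) ^+ 2.
have I0 : 0 <= I by apply: Rintegral_ge0 => x _; exact: sqr_ge0.
pose s := Num.sqrt (e + 4 * I).
have eI : 0 < e + 4 * I by rewrite ltr_pwDl// mulr_ge0.
have s0 : 0 < s by rewrite sqrtr_gt0.
have s2 : s ^+ 2 = e + 4 * I by rewrite sqr_sqrtr// ltW.
have Is : 4 * I < s ^+ 2 by rewrite s2 ltrDr.
rewrite -s2.
have -> : expR (2 / N * E) = u ^-2.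
  by rewrite /u expRN exprVn invrK -expRM_natl; congr expR; ring.
apply: (rsigma_endpoint K0 N0 u0 s0 W0 Wpi) => V WV.
have [|t0 t00 ht] := Ent_short_time m1 sX L0 hL c0 hc hC h1 Ph geo mu0 _ WV s0
  Is.
  by rewrite mu1.
exists (Num.min t0 1) => [|t]; first by rewrite lt_min t00 ltr01.
rewrite lt_min => /andP[t_gt0 /andP[tt0 t1]].
have [|[_ Efin]] := mut t; first by rewrite !ltW.
rewrite PW !sigma_fin//
  UP UQ (U_fin (esym (fineK Efin))) mule1 -!(EFinM,EFinD) lee_fin.
move=> /le_trans; apply.
rewrite /u -expRD ler_expR -subr_ge0.
have := ht t; rewrite t_gt0 tt0 => /(_ isT (ltW t1) Efin);
  rewrite EP [fine E%:E]/=.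
rewrite -subr_ge0 => H.
rewrite (_ : _ - _ = N^-1 * (t * (s * V) - (E - fine (Ent m (mu_ t)))));
  last by ring.
by rewrite mulr_ge0// invr_ge0 ltW.
Qed.

End bounded_lipschitz.

(** * Slopes under contractions and scalings *)

Section slope_contraction.
Context (R : realType) (X : completeMetricType R).

(** The comparison holds for the difference quotients at each scale and passes to the limit. It
    serves for normalisation by a constant and, with [a = 1], for truncation. *)
Lemma slope_le_contraction (L a : R) (h f : X -> R) : 0 <= L ->
  lipschitz_bound L h -> 0 <= a ->
  (forall x y, `|f x - f y| <= a * `|h x - h y|) ->
  forall x, fine (slope f x) <= a * fine (slope h x).
Proof.
move=> L0 hL a0 fh x.
have fL : lipschitz_bound (a * L) f.
  by move=> y z; apply: le_trans (fh y z) _; rewrite -mulrA ler_wpM2l.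
have hc : a * dquot h k.+1%:R^-1 x @[k --> \oo] --> a * fine (slope h x).
  by apply: cvgMr; exact: (dquot_cvg_slope L0 hL).
have fc : dquot f k.+1%:R^-1 x @[k --> \oo] --> fine (slope f x).
  exact: (dquot_cvg_slope (mulr_ge0 a0 L0) fL).
rewrite -(cvg_lim _ fc)// -(cvg_lim _ hc)//.
apply: ler_lim; [by apply/cvg_ex; eexists; exact: fc|by apply/cvg_ex; eexists;
  exact: hc|].
apply: nearW => k; have k0 : 0 < k.+1%:R^-1 :> R by rewrite invr_gt0.
apply: ge_sup => [|_ [y /= xy <-]].
  by eexists; exists x => //=; rewrite mdistxx.
apply: (@le_trans _ _ (a * (`|h y - h x| / mdist x y))).
  by rewrite mulrA ler_wpM2r ?invr_ge0 ?mdist_ge0.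
by rewrite ler_wpM2l// (dquot_ub L0 hL).
Qed.

End slope_contraction.

(** * Truncation of values to [[1/k, k]] *)

Section clip.
Context (R : realType).
Implicit Types k x y u v : R.

Definition clip k x := Num.max (Num.min x k) k^-1.

Lemma clip_contraction k x y : `|clip k x - clip k y| <= `|x - y|.
Proof.
by rewrite /clip; case: (leP x k) => ?; case: (leP y k) => ?;
  case: (leP x k^-1) => ?; case: (leP y k^-1) => ?; case: (leP k k^-1) => ?;
  rewrite ler_norml;
  have := ler_norm (x - y); have := ler_norm (- (x - y)); rewrite normrN => ? ?;
  apply/andP; split; lra.
Qed.

Lemma clip_ge k x : k^-1 <= clip k x.
Proof. by rewrite /clip le_max lexx orbT. Qed.

Lemma clip_le k x : 1 <= k -> clip k x <= k.
Proof.
move=> k1; have k0 : 0 < k by exact: lt_le_trans k1.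
by rewrite /clip ge_max ge_min lexx orbT/= (le_trans _ k1)// invf_le1.
Qed.

Lemma clip_gt0 k x : 1 <= k -> 0 < clip k x.
Proof.
move=> k1; apply: lt_le_trans (clip_ge k x).
by rewrite invr_gt0 (lt_le_trans _ k1).
Qed.

Lemma clip_id k x : k^-1 <= x <= k -> clip k x = x.
Proof. by move=> /andP[kx xk]; rewrite /clip min_l// max_l. Qed.

Lemma clip_dist k x : 0 < k -> 0 <= x <= k -> `|x - clip k x| <= k^-1.
Proof.
move=> k0 /andP[x0 xk]; rewrite /clip min_l//.
have : 0 < k^-1 by rewrite invr_gt0.
by case: (leP x k^-1) => ? ?; rewrite ler_norml; apply/andP; split; lra.
Qed.

(** A bound independent of [k], used as the dominating function when the truncation is removed. *)
Lemma clip_sqr_le k x : 1 <= k -> 0 <= x -> clip k x ^+ 2 <= 1 + x ^+ 2.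
Proof.
move=> k1 x0; have := clip_gt0 x k1.
have k0 : 0 < k by exact: lt_le_trans k1.
have : k^-1 <= 1 by rewrite invf_le1.
by rewrite /clip; case: (leP x k) => ?; case: (leP x k^-1) => ?;
  case: (leP k k^-1) => ? *; nra.
Qed.

Lemma clip_measurable d (T : measurableType d) k (f : T -> R) :
  measurable_fun setT f -> measurable_fun setT (clip k \o f).
Proof. by move=> mf; apply: measurable_maxr => //; exact: measurable_minr. Qed.

(** The tangent inequality at [u]: it controls a loss of entropy by an L^1 distance as long as
    [ln u] is bounded. *)
Lemma xlnx_sub_le u v : 0 < u -> 0 < v ->
  u * ln u - v * ln v <= (1 + ln u) * (u - v).
Proof. by move=> u0 v0; have := xlnx_tangent (ltW v0) u0; nra. Qed.

Lemma ln_sqr_bound k x : 1 <= k -> k^-1 <= x <= k -> `|ln (x ^+ 2)| <= 2 * ln k.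
Proof.
move=> k1 /andP[kx xk]; have k0 : 0 < k by exact: lt_le_trans k1.
have x0 : 0 < x by apply: lt_le_trans kx; rewrite invr_gt0.
rewrite lnX2// normrM ger0_norm// ler_wpM2l// ler_norml -lnV ?posrE//.
by rewrite !ler_ln ?posrE ?invr_gt0// kx xk.
Qed.

Lemma xlnx_clip_bound k x : 1 <= k ->
  `|clip k x ^+ 2 * ln (clip k x ^+ 2)| <= k ^+ 2 * (2 * ln k).
Proof.
move=> k1; have c0 := clip_gt0 x k1; have ck := clip_le x k1.
rewrite normrM; apply: ler_pM => //.
  by rewrite ger0_norm ?sqr_ge0// ler_pXn2r// nnegrE ltW// (lt_le_trans c0).
by apply: ln_sqr_bound => //; rewrite clip_ge.
Qed.

(** Only values below [1/k] change: there the untruncated term is at most 0, and the truncated one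
    is [- 2 * ln k / k ^+ 2], at least [- 2 / k] because [ln k <= k]. *)
Lemma xlnx_le_clip k y : 1 <= k -> 0 <= y <= k ->
  y ^+ 2 * ln (y ^+ 2) - 2 / k <= clip k y ^+ 2 * ln (clip k y ^+ 2).
Proof.
move=> k1 /andP[y0 yk]; have k0 : 0 < k by exact: lt_le_trans k1.
have ik : 0 < k^-1 by rewrite invr_gt0.
have ik1 : k^-1 <= 1 by rewrite invf_le1.
have [ky|yk1] := leP k^-1 y.
  by rewrite clip_id ?ky ?yk// lerBlDr lerDl mulr_ge0// ltW.
have -> : clip k y = k^-1 by rewrite /clip min_l// max_r// ltW.
apply: (@le_trans _ _ (- (2 / k))).
  rewrite -[leRHS]add0r lerD2r; apply: mulr_ge0_le0; first exact: sqr_ge0.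
  by rewrite ln_le0// expr_le1// (le_trans (ltW yk1)).
rewrite lnX2// lnV ?posrE// !mulrN lerN2.
have lk : ln k <= k by rewrite ltW// ln_sublinear.
rewrite (_ : 2 / k = k^-1 ^+ 2 * (2 * k)); last by field; rewrite gt_eqF.
by rewrite ler_wpM2l ?sqr_ge0// ler_wpM2l.
Qed.

End clip.

(** * The inequality without normalisation of the mass *)

Section homogeneous.
Context (R : realType) (X : completeMetricType R)
  (m : {sigma_finite_measure set (borel X) -> \bar R}) (K N : R).
Hypotheses (m1 : m setT = 1%E) (sX : separable X) (m2 : P2 m).
Hypotheses (K0 : 0 < K) (N0 : 0 < N) (cde : CDe m K N).

Let mT : (m setT < +oo)%E. Proof. by rewrite m1 ltry. Qed.

(* The logarithmic Sobolev functional of h^2 m / Z, multiplied by the mass Z,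
   with A the integral of h^2 ln (h^2). *)
Definition log_sobolev_fun (A Z : R) :=
  K * N * (expR (2 / N * (A / Z - ln Z)) - 1) * Z.

(** Truncated functions do not have unit mass, so the normalised inequality is applied to [h]
    divided by the square root of [Z], whose entropy is [A / Z - ln Z]. *)
Lemma log_sobolev_homogeneous (L c C : R) (h : X -> R) :
  0 <= L -> lipschitz_bound L h -> 0 < c -> (forall x, c <= h x) ->
  (forall x, h x <= C) ->
  log_sobolev_fun (\int[m]_x ((h x) ^+ 2 * ln ((h x) ^+ 2)))
    (\int[m]_x (h x) ^+ 2) <=
  4 * \int[m]_x (fine (slope h x)) ^+ 2.
Proof.
move=> L0 hL c0 hc hC.
have h0 x : 0 < h x := lt_le_trans c0 (hc x).
have mh : measurable_fun setT (h : borel X -> R).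
  by apply: lipschitz_measurable; exists L.
have mh2 : measurable_fun setT (fun x : borel X => h x ^+ 2).
  exact: measurable_funX.
have h2C (x : borel X) : h x ^+ 2 <= C ^+ 2.
  rewrite ler_pXn2r// nnegrE; first exact: ltW.
  exact: le_trans (ltW (h0 x)) (hC x).
have hi : m.-integrable setT (EFin \o (fun x : borel X => h x ^+ 2)).
  by apply: (bounded_integrable mT mh2 (M := C ^+ 2)) => x;
    rewrite ger0_norm ?sqr_ge0.
set A := \int[m]_x _; set Z := \int[m]_x (h x ^+ 2);
  set S := \int[m]_x (_ ^+ 2).
have Z0 : 0 < Z.
  apply: (@lt_le_trans _ _ (\int[m]_x (c ^+ 2))).
    by rewrite Rintegral_cst// (congr1 fine m1) mulr1 exprn_gt0.
  apply: le_Rintegral => //.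
    by apply: (bounded_integrable mT (M := `|c ^+ 2|)) => // x.
  by move=> x _; rewrite ler_pXn2r// nnegrE ltW.
pose a := (Num.sqrt Z)^-1.
have a0 : 0 < a by rewrite invr_gt0 sqrtr_gt0.
have a2 : a ^+ 2 = Z^-1 by rewrite exprVn sqr_sqrtr// ltW.
pose g x := a * h x.
have gh x y : `|g x - g y| <= a * `|h x - h y|.
  by rewrite -mulrBr normrM (ger0_norm (ltW a0)).
have gL : lipschitz_bound (a * L) g.
  by move=> x y; apply: le_trans (gh x y) _; rewrite -mulrA ler_wpM2l// ltW.
have g1 : \int[m]_x (g x) ^+ 2 = 1.
  under eq_Rintegral do rewrite exprMn a2.
  by rewrite RintegralZl// mulVf// gt_eqF.
have := @log_sobolev_lipschitz _ _ m K N m1 sX m2 K0 N0 cde (a * L) (a * c) (a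
  * C) g.
move=> /(_ (mulr_ge0 (ltW a0) L0) gL (mulr_gt0 a0 c0)).
have gc x : a * c <= g x by rewrite ler_wpM2l// ltW.
have gC x : g x <= a * C by rewrite ler_wpM2l// ltW.
move=> /(_ gc gC g1) ls.
have lbnd (x : borel X) : `|ln (h x ^+ 2)| <= `|ln (c ^+ 2)| + `|ln (C ^+ 2)|.
  have C0 : 0 < C := lt_le_trans (h0 x) (hC x).
  have c2 : ln (c ^+ 2) <= ln (h x ^+ 2).
    by rewrite ler_ln ?posrE ?exprn_gt0// ler_pXn2r// nnegrE ltW.
  have C2 : ln (h x ^+ 2) <= ln (C ^+ 2) by rewrite ler_ln// posrE exprn_gt0.
  rewrite ler_norml; have := ler_norm (ln (C ^+ 2)).
  have := ler_norm (- ln (c ^+ 2)); rewrite normrN.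
  have := normr_ge0 (ln (C ^+ 2)); have := normr_ge0 (ln (c ^+ 2)).
  by move=> *; apply/andP; split; lra.
have hli : m.-integrable setT
    (EFin \o (fun x : borel X => h x ^+ 2 * ln (h x ^+ 2))).
  apply: (bounded_integrable mT
    (M := C ^+ 2 * (`|ln (c ^+ 2)| + `|ln (C ^+ 2)|))).
    by apply: measurable_funM => //; exact: measurableT_comp mh2.
  by move=> x; rewrite normrM ler_pM// ger0_norm ?sqr_ge0.
have EA : \int[m]_x ((g x) ^+ 2 * ln ((g x) ^+ 2)) = A / Z - ln Z.
  rewrite (_ : \int[m]_x _ = \int[m]_x (Z^-1 * (h x ^+ 2 * ln (h x ^+ 2)) -
      Z^-1 * ln Z * h x ^+ 2)); last first.
    apply: eq_Rintegral => x _;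
      rewrite exprMn a2 lnM ?posrE ?invr_gt0 ?exprn_gt0//.
    by rewrite lnV ?posrE//; ring.
  rewrite RintegralB//; [|exact: (integrableZl measurableT Z^-1 hli)
    |exact: (integrableZl measurableT (Z^-1 * ln Z) hi)].
  by rewrite !RintegralZl// -/A -/Z; field; rewrite gt_eqF.
have ES : \int[m]_x (fine (slope g x)) ^+ 2 <= Z^-1 * S.
  have si := slope_sqr_integrable mT L0 hL.
  rewrite -RintegralZl//; apply: le_Rintegral => //.
  - exact: (slope_sqr_integrable mT (mulr_ge0 (ltW a0) L0) gL).
  - exact: (integrableZl measurableT Z^-1 si).
  move=> x _; rewrite -a2 -exprMn ler_pXn2r ?nnegrE//.
  - exact: (slope_le_contraction L0 hL (ltW a0) gh).
  - by rewrite fine_ge0// slope_ge0.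
  - by rewrite mulr_ge0 ?(ltW a0)// fine_ge0// slope_ge0.
rewrite /log_sobolev_fun -ler_pdivlMr// -EA; apply: le_trans ls _.
by rewrite -mulrA ler_wpM2l// mulrC.
Qed.

Lemma log_sobolev_fun_mono (A B Z : R) : 0 < Z -> A <= B ->
  log_sobolev_fun A Z <= log_sobolev_fun B Z.
Proof.
move=> Z0 AB; have KN : 0 <= K * N by rewrite mulr_ge0 ?ltW.
have N2 : 0 <= 2 / N by rewrite divr_ge0 ?ltW.
have iZ : 0 <= Z^-1 by rewrite invr_ge0 ltW.
rewrite /log_sobolev_fun (ler_wpM2r (ltW Z0))// (ler_wpM2l KN)//
  lerD2r ler_expR.
by rewrite (ler_wpM2l N2)// lerD2r (ler_wpM2r iZ).
Qed.

Lemma log_sobolev_fun_cvg (A_ Z_ : nat -> R) (A Z : R) : 0 < Z ->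
  A_ n @[n --> \oo] --> A -> Z_ n @[n --> \oo] --> Z ->
  log_sobolev_fun (A_ n) (Z_ n) @[n --> \oo] --> log_sobolev_fun A Z.
Proof.
move=> Z0 cA cZ; apply: cvgM => //; apply: cvgMr; apply: cvgB;
  last exact: cvg_cst.
apply: (@continuous_cvg _ R R _ _ _ (@expR R)); first exact: continuous_expR.
apply: cvgMr; apply: cvgB.
  by apply: cvgM => //; apply: cvgV => //; rewrite gt_eqF.
by apply: (@continuous_cvg _ R R _ _ _ (@ln R)) => //; exact: continuous_ln.
Qed.

End homogeneous.

(** * Truncation and approximation *)

Section limn_einf.
Context (R : realType).
Implicit Types (u v : (\bar R)^nat) (l : \bar R).
Local Open Scope ereal_scope.

Lemma limn_einf_ge u v l : u @ \oo --> l -> (\forall n \near \oo, u n <= v n) ->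
  l <= limn_einf v.
Proof.
move=> ul [n0 _ uv]; rewrite limn_einf_lim -(cvg_lim _ (cvg_einfs ul))//.
apply: lee_lim; [exact: is_cvg_einfs|exact: is_cvg_einfs|].
exists n0 => // n /= n0n; apply: le_ereal_inf_tmp => _ [k /= nk <-].
apply: le_trans (uv k (leq_trans n0n nk)).
by apply: ereal_inf_lbound; exists k.
Qed.

Lemma limn_einf_le u v l : v @ \oo --> l -> (\forall n \near \oo, u n <= v n) ->
  limn_einf u <= l.
Proof.
move=> vl [n0 _ uv]; rewrite limn_einf_lim -(cvg_lim _ (cvg_einfs vl))//.
apply: lee_lim; [exact: is_cvg_einfs|exact: is_cvg_einfs|].
exists n0 => // n /= n0n; apply: le_ereal_inf_tmp => _ [k /= nk <-].
apply: le_trans (uv k (leq_trans n0n nk)).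
by apply: ereal_inf_lbound; exists k.
Qed.

End limn_einf.

Section approximation.
Context (R : realType) (X : completeMetricType R)
  (m : {sigma_finite_measure set (borel X) -> \bar R}) (K N : R).
Hypotheses (m1 : m setT = 1%E) (sX : separable X) (m2 : P2 m).
Hypotheses (K0 : 0 < K) (N0 : 0 < N) (cde : CDe m K N).
Variables (f : borel X -> R) (f_ : nat -> X -> R).
Hypotheses (mf : measurable_fun setT f) (f0 : forall x, 0 <= f x)
  (fi : m.-integrable setT (EFin \o (fun x => f x ^+ 2)))
  (f1 : \int[m]_x (f x) ^+ 2 = 1) (f_f : lipschitz_approx m f f_).

Let mT : (m setT < +oo)%E. Proof. by rewrite m1 ltry. Qed.

Let energy n :=
  (2^-1%:E * \int[m]_(x in [set: borel X]) (slope (f_ n) x) ^+ 2)%E.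

Let mf_ n : measurable_fun setT (f_ n : borel X -> R).
Proof. exact: lipschitz_measurable (f_f.1 n). Qed.

Lemma lipschitz_approx_sqr (e : R) : 0 < e ->
  \forall n \near \oo, (\int[m]_x ((f_ n x - f x) ^+ 2)%:E <= (e ^+ 2)%:E)%E.
Proof.
move=> e0; have [_ f_f2] := f_f.
have : \forall n \near \oo,
    ('N[m]_2%:E[(fun x : borel X => (f_ n x - f x)%:E)] < e%:E)%E.
  have /fine_cvgP[finN /cvgr_lt/(_ _ e0)] := f_f2;
    apply: filterS2 finN => n finN.
  by rewrite -lte_fin /= fineK.
apply: filterS => n Nn.
have -> : (\int[m]_x ((f_ n x - f x) ^+ 2)%:E =
    'N[m]_2%:E[(fun x : borel X => (f_ n x - f x)%:E)] `^ 2)%E.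
  rewrite poweR_Lnorm//; apply: eq_integral => x _.
  by rewrite /= powR_mulrn// real_normK// num_real.
move: Nn; have := Lnorm_ge0 m 2%:E (fun x : borel X => (f_ n x - f x)%:E).
case: ('N[m]_2%:E[_])%E => [r| |]//=; rewrite !lee_fin !lte_fin => r0 re.
have e2 : 0 <= e by rewrite ltW.
by rewrite powR_mulrn// ler_pXn2r ?nnegrE// ltW.
Qed.

(** * Passage to the limit in the approximating sequence at a fixed truncation level *)

Section fixed_level.
Variable k : R.
Hypothesis k1 : 1 <= k.

Let k0 : 0 < k. Proof. exact: lt_le_trans k1. Qed.

Let c x := clip k (f x).
Let c_ n x := clip k (f_ n x).

Let mc2 : measurable_fun setT (fun x => c x ^+ 2).
Proof. by apply: measurable_funX; exact: clip_measurable. Qed.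

Let mc_2 n : measurable_fun setT (fun x : borel X => c_ n x ^+ 2).
Proof. by apply: measurable_funX; exact: clip_measurable. Qed.

Let sqr_bound y : `|clip k y ^+ 2| <= k ^+ 2.
Proof.
have c0 := clip_gt0 y k1.
rewrite ger0_norm ?sqr_ge0// ler_pXn2r// ?nnegrE ?(ltW c0) ?(ltW k0)//.
exact: clip_le.
Qed.

Let c2i : m.-integrable setT (EFin \o (fun x => c x ^+ 2)).
Proof. exact: (bounded_integrable mT mc2 (fun x => sqr_bound (f x))). Qed.

Let c_2i n : m.-integrable setT (EFin \o (fun x : borel X => c_ n x ^+ 2)).
Proof. exact: (bounded_integrable mT (mc_2 n) (fun x => sqr_bound (f_ n x))).
  Qed.

Let cli : m.-integrable setT (EFin \o (fun x => c x ^+ 2 * ln (c x ^+ 2))).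
Proof.
apply: (bounded_integrable mT (M := k ^+ 2 * (2 * ln k))) => [|x].
  by apply: measurable_funM => //; exact: measurableT_comp mc2.
exact: xlnx_clip_bound.
Qed.

Let c_li n : m.-integrable setT
  (EFin \o (fun x : borel X => c_ n x ^+ 2 * ln (c_ n x ^+ 2))).
Proof.
apply: (bounded_integrable mT (M := k ^+ 2 * (2 * ln k))) => [|x].
  by apply: measurable_funM => //; exact: measurableT_comp (mc_2 n).
exact: xlnx_clip_bound.
Qed.

Let delta n := \int[m]_x `|c x ^+ 2 - c_ n x ^+ 2|.

Let dBi n : m.-integrable setT (EFin \o (fun x => c x ^+ 2 - c_ n x ^+ 2)).
Proof. exact: (integrableB measurableT c2i (c_2i n)). Qed.

Let di n : m.-integrable setT (EFin \o (fun x => `|c x ^+ 2 - c_ n x ^+ 2|)).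
Proof. exact: (integrable_norm (dBi n)). Qed.

(** The difference of squares is at most [2 * k] times the distance of [f x] and [f_ n x], and
    [t <= d + t ^+ 2 / d] converts L^2 closeness into L^1 closeness. *)
Lemma clip_L1_cvg : delta n @[n --> \oo] --> 0.
Proof.
apply/cvgr0Pnorm_le => e e0;
  (* With this [d] the final bound [2 * k * d + 2 * k / d * d ^+ 2] equals [e]. *)
  have [d dE] : exists d, d = e / (4 * k) by exists (e / (4 * k)).
have d0 : 0 < d by rewrite dE divr_gt0// mulr_gt0.
have := lipschitz_approx_sqr d0; apply: filterS => n dn.
have D0 x : 0 <= (f_ n x - f x) ^+ 2 by exact: sqr_ge0.
have Di : m.-integrable setT (EFin \o (fun x => (f_ n x - f x) ^+ 2)).
  apply/integrableP; split.
    by apply/measurable_EFinP/measurable_funX; exact: measurable_funB.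
  under eq_integral do rewrite /= ger0_norm//.
  exact: le_lt_trans dn (ltry _).
have D2 : \int[m]_x (f_ n x - f x) ^+ 2 <= d ^+ 2
  by rewrite -lee_fin EFin_Rintegral.
rewrite ger0_norm; last by apply: Rintegral_ge0.
have ki : m.-integrable setT (EFin \o cst (2 * k * d)).
  by apply: (bounded_integrable mT (M := `|2 * k * d|)) => // x.
have kDi : m.-integrable setT (EFin \o (fun x =>
  2 * k / d * (f_ n x - f x) ^+ 2)).
  exact: (integrableZl measurableT _ Di).
apply: (@le_trans _ _
  (\int[m]_x (2 * k * d + 2 * k / d * (f_ n x - f x) ^+ 2))).
  apply: le_Rintegral => // [|x _].
    exact: (integrableD measurableT ki kDi).
  have c0 := clip_gt0 (f x) k1; have c_0 := clip_gt0 (f_ n x) k1.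
  have ck := clip_le (f x) k1; have c_k := clip_le (f_ n x) k1.
  have cc := clip_contraction k (f x) (f_ n x).
  rewrite subr_sqr normrM.
  have s1 : `|c x + c_ n x| <= 2 * k.
    rewrite /c /c_ ger0_norm ?addr_ge0 ?(ltW c0) ?(ltW c_0)//.
    by rewrite mulr_natl mulr2n lerD.
  apply: (@le_trans _ _ (`|f x - f_ n x| * (2 * k))); first exact: ler_pM.
  have y : `|f x - f_ n x| <= d + (f_ n x - f x) ^+ 2 / d.
    rewrite -(real_normK (num_real (f_ n x - f x))) [`|f_ n x - _|]distrC.
    have := normr_ge0 (f x - f_ n x); set t := `|_| => t0.
    rewrite -subr_ge0 (_ : _ - _ = ((t - d) ^+ 2 + t * d) / d); last by field;
      rewrite gt_eqF.
    by rewrite divr_ge0 ?(ltW d0)// addr_ge0 ?sqr_ge0// mulr_ge0 ?(ltW d0).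
  apply: le_trans (ler_wpM2r _ y) _; first by rewrite mulr_ge0 ?(ltW k0).
  by rewrite le_eqVlt; apply/orP; left; apply/eqP; ring.
rewrite RintegralD// [X in _ + X]RintegralZl// Rintegral_cst//
  (congr1 fine m1) mulr1.
apply: (@le_trans _ _ (2 * k * d + 2 * k / d * d ^+ 2)).
  by rewrite lerD2l ler_wpM2l// divr_ge0 ?mulr_ge0 ?(ltW k0) ?(ltW d0).
rewrite le_eqVlt; apply/orP; left; apply/eqP.
by rewrite dE; field; rewrite !gt_eqF.
Qed.

(** The inequality is applied to each truncated [f_ n], whose slope is at most that of [f_ n]. The
    factor 8 arises because [energy] is half the integral of the squared slope, which is bounded
    below through 4 times that integral. *)
Lemma log_sobolev_fun_clip_le :
  ((8^-1 * log_sobolev_fun K N (\int[m]_x (c x ^+ 2 * ln (c x ^+ 2)))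
    (\int[m]_x (c x ^+ 2)))%:E
    <= limn_einf energy)%E.
Proof.
set A := \int[m]_x (_ * _); set Z := \int[m]_x _.
pose A_ n := \int[m]_x (c_ n x ^+ 2 * ln (c_ n x ^+ 2)).
pose Z_ n := \int[m]_x (c_ n x ^+ 2).
have lower (g : borel X -> R) :
    m.-integrable setT (EFin \o (fun x => clip k (g x) ^+ 2)) ->
    0 < \int[m]_x (clip k (g x) ^+ 2).
  move=> gi; apply: (@lt_le_trans _ _ (\int[m]_x (k^-1 ^+ 2))).
    by rewrite Rintegral_cst// (congr1 fine m1) mulr1 exprn_gt0// invr_gt0.
  apply: le_Rintegral => //.
    by apply: (bounded_integrable mT (M := `|k^-1 ^+ 2|)) => // x.
  move=> x _; rewrite ler_pXn2r ?nnegrE ?invr_ge0 ?(ltW k0)//.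
    exact: clip_ge.
  exact: ltW (clip_gt0 _ k1).
have Z0 : 0 < Z := lower _ c2i.
have Z_0 n : 0 < Z_ n := lower _ (c_2i n).
(* On [[1/k, k]] this bounds the factor [1 + ln (c x ^+ 2)] of the tangent inequality. *)
pose b := 1 + 2 * ln k.
have b0 : 0 <= b by rewrite addr_ge0// mulr_ge0// ln_ge0.
have ZZ n : `|Z - Z_ n| <= delta n.
  by rewrite -RintegralB//; apply: le_normr_Rintegral.
(* A lower bound on [A_ n] suffices, the functional being increasing in its first argument. *)
have AA n : A - b * delta n <= A_ n.
  rewrite lerBlDr -lerBlDl -RintegralB// -RintegralZl//.
  apply: le_Rintegral => //.
  - exact: (integrableB measurableT cli (c_li n)).
  - exact: (integrableZl measurableT b (di n)).
  move=> x _; have c0 := clip_gt0 (f x) k1; have c_0 := clip_gt0 (f_ n x) k1.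
  apply: le_trans (xlnx_sub_le _ _) _; rewrite ?exprn_gt0//.
  apply: le_trans (ler_norm _) _; rewrite normrM ler_wpM2r//.
  apply: le_trans (ler_normD _ _) _; rewrite normr1 lerD2l.
  by apply: ln_sqr_bound => //; rewrite clip_ge clip_le.
have cA : A - b * delta n @[n --> \oo] --> A.
  rewrite -[X in _ --> X]subr0; apply: cvgB; first exact: cvg_cst.
  by rewrite -(mulr0 b); apply: cvgMr; exact: clip_L1_cvg.
have cZ : Z_ n @[n --> \oo] --> Z.
  apply/cvgrPdist_le => e e0; have := clip_L1_cvg => /cvgr0Pnorm_le/(_ _ e0).
  apply: filterS => n dn; apply: le_trans (ZZ n) (le_trans (ler_norm _) dn).
have cF := log_sobolev_fun_cvg (K := K) (N := N) Z0 cA cZ.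
apply: (@limn_einf_ge _ (fun n =>
  (8^-1 * log_sobolev_fun K N (A - b * delta n) (Z_ n))%:E)).
  by apply: cvg_EFin; [exact: nearW|apply: cvgMr; exact: cF].
apply: nearW => n; have [L L0 fL] := is_lipschitzP (f_f.1 n).
have cL : lipschitz_bound L (c_ n).
  by move=> x y; apply: le_trans (clip_contraction _ _ _) (fL x y).
rewrite /energy (Rintegral_slope_sqr mT L0 fL) -EFinM lee_fin.
have := @log_sobolev_homogeneous _ _ m K N m1 sX m2 K0 N0 cde L k^-1 k (c_ n)
  L0 cL.
rewrite invr_gt0 => /(_ k0 (fun x => clip_ge _ _) (fun x => clip_le _ k1)) ls.
have FF := log_sobolev_fun_mono K0 N0 (Z_0 n) (AA n).
have SS : \int[m]_x (fine (slope (c_ n) x)) ^+ 2 <=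
    \int[m]_x (fine (slope (f_ n) x)) ^+ 2.
  apply: le_Rintegral => //.
  - exact: (slope_sqr_integrable mT L0 cL).
  - exact: (slope_sqr_integrable mT L0 fL).
  move=> x _; rewrite ler_pXn2r ?nnegrE ?fine_ge0 ?slope_ge0//.
  rewrite -[leRHS]mul1r; apply: (slope_le_contraction L0 fL ler01).
  by move=> y z; rewrite mul1r; exact: clip_contraction.
have := le_trans FF ls; rewrite -/(Z_ n) => FS.
rewrite ler_pdivrMl//; apply: le_trans FS _.
by rewrite (_ : 8 * _ = 4 * \int[m]_x (fine (slope (f_ n) x)) ^+ 2)
  ?ler_wpM2l//; lra.
Qed.

End fixed_level.

(** * Removal of the truncation *)

Let psi y : R := y ^+ 2 * ln (y ^+ 2).
Let kj j : R := j.+1%:R.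
Let kj1 j : 1 <= kj j. Proof. by rewrite ler1n. Qed.
Let kj0 j : 0 < kj j. Proof. by rewrite ltr0n. Qed.

Let clip_meas j : measurable_fun setT (fun x => clip (kj j) (f x) ^+ 2).
Proof. by apply: measurable_funX; exact: clip_measurable. Qed.

Let near_le_kj x : \forall j \near \oo, f x <= kj j.
Proof.
have [n fn] : exists n : nat, f x < n%:R.
  by exists (Num.bound (f x)); exact: archi_boundP.
exists n => // j /= nj; apply: le_trans (ltW fn) _.
by rewrite ler_nat (leq_trans nj).
Qed.

Lemma clip_sqr_integral_cvg :
  \int[m]_x (clip (kj j) (f x) ^+ 2) @[j --> \oo] --> (1 : R).
Proof.
have := @dominated_convergence _ _ _ m setT measurableT
  (fun j x => (clip (kj j) (f x) ^+ 2)%:E) (fun x => (f x ^+ 2)%:E)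
  (fun x => (1 + f x ^+ 2)%:E).
case => //.
- by move=> j; exact/measurable_EFinP.
- by apply/measurable_EFinP; exact: measurable_funX.
- apply: aeW => x _; apply: cvg_EFin; first exact: nearW.
  rewrite /comp/=; apply: (@continuous_cvg _ R R _ _ _ (fun y : R => y ^+ 2)).
    exact: exprn_continuous.
  apply/cvgrPdist_le => e e0; near=> j; apply: le_trans (clip_dist (kj0 j) _) _.
    by rewrite f0/=; near: j; exact: near_le_kj.
  by apply: ltW; near: j; exact: (near_infty_natSinv_lt (PosNum e0)).
- apply: (integrableD measurableT (f := cst 1%:E)) fi => //.
  by apply: (bounded_integrable mT (f := cst 1) (M := 1)) => // x;
    rewrite normr1.
- apply: aeW => x j _; rewrite lee_fin ger0_norm ?sqr_ge0//.
  exact: clip_sqr_le.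
move=> _ _ H; apply: fine_cvg; rewrite -f1 EFin_Rintegral//.
Unshelve. all: by end_near. Qed.

(** Finiteness of the entropy is part of the conclusion: the truncated inequalities bound the
    truncated entropies uniformly, and Fatou's lemma transfers the bound to [f]. *)
Lemma lipschitz_approx_log_sobolev (a : R) : (limn_einf energy <= a%:E)%E ->
  m.-integrable setT (EFin \o (fun x => psi (f x))) /\
  K * N * (expR (2 / N * \int[m]_x psi (f x)) - 1) <= 8 * a.
Proof.
move=> la.
pose Z_ j := \int[m]_x (clip (kj j) (f x) ^+ 2).
pose A_ j := \int[m]_x psi (clip (kj j) (f x)).
have a0 : 0 <= a.
  rewrite -lee_fin; apply: le_trans la; apply: (@limn_einf_ge _ (cst 0%E)).
    exact: cvg_cst.
  apply: nearW => n; rewrite mule_ge0// ?lee_fin ?invr_ge0//.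
  by apply: integral_ge0 => x _; exact: expe_ge0 (slope_ge0 _ _).
have KN0 : 0 < K * N by rewrite mulr_gt0.
have ls j : log_sobolev_fun K N (A_ j) (Z_ j) <= 8 * a.
  by have := le_trans (log_sobolev_fun_clip_le (kj1 j)) la;
    rewrite lee_fin ler_pdivrMl.
have Zcvg : Z_ j @[j --> \oo] --> (1 : R) by exact: clip_sqr_integral_cvg.
have mpsi (g : borel X -> R) : measurable_fun setT g ->
    measurable_fun setT (fun x => psi (g x)).
  move=> mg; have mg2 : measurable_fun setT (fun x => g x ^+ 2).
    exact: measurable_funX.
  by apply: measurable_funM => //; exact: measurableT_comp mg2.
have mpsij j : measurable_fun setT (fun x => psi (clip (kj j) (f x))).
  by apply: mpsi; exact: clip_measurable.
have psiji j : m.-integrable setT (EFin \o (fun x => psi (clip (kj j) (f x)))).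
  by apply: (bounded_integrable mT (mpsij j)) => x; exact: xlnx_clip_bound.
have Z_gt0 : \forall j \near \oo, 0 < Z_ j by exact: cvgr_gt Zcvg _ ltr01.
(* The inequality [log_sobolev_fun K N A z <= 8 * a] solved for [A]. *)
pose B z := z * (ln z + N / 2 * ln (1 + 8 * a / (K * N * z))).
have AB : \forall j \near \oo, A_ j <= B (Z_ j).
  apply: filterS Z_gt0 => j Zj; have KNZ : 0 < K * N * Z_ j by rewrite mulr_gt0.
  have r0 : 0 <= 8 * a / (K * N * Z_ j) by rewrite divr_ge0 ?(ltW KNZ)//
    mulr_ge0.
  have := ls j; rewrite /log_sobolev_fun -ler_pdivlMr// -ler_pdivlMl//
    lerBlDl => h.
  have {}h : 2 / N * (A_ j / Z_ j - ln (Z_ j)) <=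
      ln (1 + 8 * a / (K * N * Z_ j)).
    rewrite -ler_expR lnK ?posrE ?ltr_wpDr//; apply: le_trans h _.
    by rewrite lerD2l le_eqVlt; apply/orP; left; apply/eqP; field;
      rewrite !gt_eqF.
  rewrite /B mulrC -ler_pdivrMr// -lerBlDl.
  rewrite (_ : N / 2 = (2 / N)^-1); last by rewrite invf_div.
  by rewrite ler_pdivlMl// divr_gt0.
have Bcvg : B (Z_ j) @[j --> \oo] --> N / 2 * ln (1 + 8 * a / (K * N)).
  rewrite [X in _ --> X](_ : _ = B 1); last by rewrite /B ln1 add0r mul1r mulr1.
  apply: cvgM => //; apply: cvgD.
    by apply: (@continuous_cvg _ R R _ _ _ (@ln R)) => //; exact: continuous_ln.
  apply: cvgMr; apply: (@continuous_cvg _ R R _ _ _ (@ln R)).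
    apply: continuous_ln; rewrite ltr_wpDr// mulr1.
    by rewrite divr_ge0 ?mulr_ge0 ?(ltW K0) ?(ltW N0).
  apply: cvgD; first exact: cvg_cst.
  apply: cvgMr; apply: cvgV; first by rewrite mulr1 gt_eqF.
  exact: cvgMr.
set B1 := N / 2 * _ in Bcvg.
(* Adding 1 makes the integrand nonnegative, as Fatou's lemma requires, because [x * ln x >= -1]. *)
pose w j x : \bar R := (psi (clip (kj j) (f x)) + 1)%:E.
have mw j : measurable_fun setT (w j).
  by apply/measurable_EFinP; exact: measurable_funD.
have w0 j x : setT x -> (0 <= w j x)%E.
  move=> _; rewrite lee_fin -lerBlDr sub0r; apply: xlnx_geN1; exact: sqr_ge0.
have i1 : m.-integrable setT (EFin \o cst (1 : R)).
  by apply: (bounded_integrable mT (M := 1)) => // x; rewrite normr1.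
have fatouw := fatou m measurableT mw w0.
have wint : (limn_einf (fun j => \int[m]_x w j x) <= (B1 + 1)%:E)%E.
  apply: (@limn_einf_le _ _ (fun j => (B (Z_ j) + 1)%:E)).
    by apply: cvg_EFin; [exact: nearW|apply: cvgD => //; exact: cvg_cst].
  apply: filterS AB => j ABj; rewrite -EFin_Rintegral; last first.
    exact: (integrableD measurableT (psiji j) i1).
  by rewrite RintegralD// Rintegral_cst// (congr1 fine m1) mulr1 lee_fin lerD2r.
have mpsif := mpsi _ mf.
have psi1 : (\int[m]_x (psi (f x) + 1)%:E <= (B1 + 1)%:E)%E.
  apply: le_trans (le_trans fatouw wint); apply: ge0_le_integral => //.
  - by move=> x _; rewrite lee_fin -lerBlDr sub0r; apply: xlnx_geN1;
      exact: sqr_ge0.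
  - by apply/measurable_EFinP; exact: measurable_funD.
  - apply: measurableT_comp => //; apply: measurable_fun_limn_esup => j.
    exact: measurableT_comp (mw j).
  (* Once the level exceeds [f x], truncation lowers [psi (f x)] by at most [2 / kj j], which tends
     to 0. *)
  move=> x _; apply: (@limn_einf_ge _ (fun j =>
    (psi (f x) + 1 - 2 * (kj j)^-1)%:E)).
    apply: cvg_EFin; first exact: nearW.
    rewrite -[X in _ --> X]subr0; apply: cvgB; first exact: cvg_cst.
    by rewrite -(mulr0 2); apply: cvgMr; exact: cvg_harmonic.
  apply: filterS (near_le_kj x) => j fj; rewrite lee_fin addrAC lerD2r.
  by apply: xlnx_le_clip => //; rewrite f0.
have p1i : m.-integrable setT (EFin \o (fun x => psi (f x) + 1)).
  apply/integrableP; split; first by apply/measurable_EFinP;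
    exact: measurable_funD.
  under eq_integral => x _.
    rewrite /= ger0_norm; last first.
      by rewrite -lerBlDr sub0r; apply: xlnx_geN1; exact: sqr_ge0.
    over.
  exact: le_lt_trans psi1 (ltry _).
have psii : m.-integrable setT (EFin \o (fun x => psi (f x))).
  have := integrableB measurableT p1i i1.
  by apply: eq_integrable => // x _; rewrite /= -EFinB addrK.
split=> //.
have : \int[m]_x psi (f x) <= B1.
  rewrite -(lerD2r 1) -[X in _ + X <= _](mul1r 1) -[X in _ + _ * X <=
    _](congr1 fine m1).
  rewrite -(@Rintegral_cst _ _ _ m setT)// -RintegralD//
    -lee_fin EFin_Rintegral//.
move=> h; rewrite mulrC -ler_pdivlMr// lerBlDl.
have r0 : 0 <= 8 * a / (K * N)
  by rewrite divr_ge0 ?mulr_ge0 ?(ltW K0) ?(ltW N0).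
rewrite -[leRHS]lnK ?posrE ?ltr_wpDr// ler_expR.
rewrite (_ : 2 / N = (N / 2)^-1); last by rewrite invf_div.
by rewrite ler_pdivrMl// divr_gt0.
Qed.

End approximation.

(** * The inequality for arbitrary absolutely continuous measures *)

Unset Implicit Arguments.

Theorem corollary3p28 (R : realType) (X : completeMetricType R)
    (m : {sigma_finite_measure set (borel X) -> \bar R}) (K N : R) :
  separable X -> locally_finite m ->
  0 < K -> 0 < N -> CDe m K N -> P2 m ->
  forall mu : probability (borel X) R, P2ac m mu ->
    ((K * N)%:E * (expeR ((2 / N)%:E * Ent m mu) - 1) <= Fisher m mu)%E.
Proof.
move=> sX _ K0 N0 cde m2 mu [_ mum]; have [m1 _] := m2.
rewrite /Fisher; case: asboolP => [_|//].
(* [Ch] is an infimum, so it is enough to bound the lower limit of the energies of each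
   approximating sequence. *)
rewrite -lee_pdivrMl//; apply: le_ereal_inf_tmp => _ [f_ f_f <-].
set l := limn_einf _.
have l0 : (0 <= l)%E.
  apply: (@limn_einf_ge _ (cst 0%E)); first exact: cvg_cst.
  apply: nearW => n; rewrite mule_ge0// ?lee_fin ?invr_ge0//.
  by apply: integral_ge0 => x _; exact: expe_ge0 (slope_ge0 _ _).
have [->|lfin] := eqVneq l +oo%E; first by rewrite leey.
have lE : l = (fine l)%:E by rewrite fineK// ge0_fin_numE// ltey.
set f := (fun x => Num.sqrt (density m mu x)) in f_f.
have ff x : f x ^+ 2 = density m mu x by rewrite sqr_sqrtr// density_ge0.
have mf : measurable_fun setT f.
  rewrite (_ : f = (@powR R ^~ 2^-1) \o density m mu).
    exact: measurableT_comp (measurable_powR _) (density_measurable mum).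
  by apply/funext => x; rewrite /= powR12_sqrt// density_ge0.
have f0 x : 0 <= f x by exact: sqrtr_ge0.
have fi : m.-integrable setT (EFin \o (fun x => f x ^+ 2)).
  by apply: eq_integrable (density_integrable mum) => // x _; rewrite /= ff.
have f1 : \int[m]_x (f x) ^+ 2 = 1.
  by rewrite -(Rintegral_density1 mum); apply: eq_Rintegral => x _; rewrite ff.
have la : (l <= (fine l)%:E)%E by rewrite -lE.
have [psii ls] := lipschitz_approx_log_sobolev m1 sX m2 K0 N0 cde mf f0 fi f1
  f_f la.
have dd x : f x ^+ 2 * ln (f x ^+ 2) = density m mu x * ln (density m mu x).
  by rewrite ff.
have ddi : m.-integrable setT (EFin \o (fun x =>
  density m mu x * ln (density m mu x))).
  by apply: eq_integrable psii => // x _; rewrite /= dd.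
(* The integrability just obtained selects the integral branch of [Ent]. *)
have EE : Ent m mu = (\int[m]_x (f x ^+ 2 * ln (f x ^+ 2)))%:E.
  rewrite EFin_Rintegral// /Ent; case: asboolP => [_|[]].
    by apply: eq_integral => x _; rewrite dd.
  split => //; have := integrable_funrpos measurableT ddi.
  by apply: eq_integrable => // x _.
by rewrite EE lE /= -EFinB -!EFinM lee_fin ler_pdivrMl.
Qed.
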